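(* Let $E,A\in\mathbb{R}^{n\times n}$ be such that the matrix pair $(E,A)$ is regular, let $f:\mathbb{R}\to\mathbb{R}^n$ be a source term, and consider the initial value problem $E\dot x(t)=Ax(t)+f(t)$, $x(0)=x_0$, with Laplace-transformed solution $\hat x$. Let $f_{\mathrm{diff}}$ and $f_{\mathrm{imp}}$ be the differential and impulsive parts of the source and let $\nu$ be the index, as defined in the context. Assume that there is a real number $\alpha<1$ such that $$\lim_{|z|\to\infty}\frac{\|\hat f_{\mathrm{diff}}(z)\|}{|z|^{\alpha}}\ \le\ C\quad\text{for some constant } C,$$ and that $$\lim_{|z|\to\infty}\big\|\widehat{f^{(j)}_{\mathrm{imp}}}(z)\big\|=0,\qquad j=0,\ldots,\nu-1,$$ where $\widehat{f^{(j)}_{\mathrm{imp}}}$ denotes the Laplace transform of the $j$-th time derivative of $f_{\mathrm{imp}}$. Then the integrand $e^{zt}\hat x(z)$ of the inverse Laplace transform of $\hat x$ along the vertical line $\operatorname{Re} z=\gamma$ decays, i.e. $$\lim_{|\omega|\to\infty}\big\|e^{(\gamma+\mathbf{i}\omega)t}\,\hat x(\gamma+\mathbf{i}\omega)\big\|=0 .$$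
   Context: $\|\cdot\|$ is the Euclidean norm (and the induced spectral norm for matrices); $\mathbf{i}$ is the imaginary unit; a hat denotes the Laplace transform. The matrix $E$ is singular in the setting of interest. The pair $(E,A)$ is regular if $\det(zE-A)$ is not the zero polynomial in $z$. Then there exist invertible $S,T\in\mathbb{R}^{n\times n}$ giving the quasi-Weierstrass form $$SET=\begin{bmatrix} I_{n_J}&0\\0&N\end{bmatrix},\qquad SAT=\begin{bmatrix} J&0\\0&I_{n_N}\end{bmatrix},$$ with $J\in\mathbb{R}^{n_J\times n_J}$, $n_J+n_N=n$, and $N\in\mathbb{R}^{n_N\times n_N}$ nilpotent with nilpotency index $\nu$ (called the index of the differential-algebraic equation). Define $f_{\mathrm{diff}}(t)=[I_{n_J}\ \ 0]\,Sf(t)$ and $f_{\mathrm{imp}}(t)=[0\ \ I_{n_N}]\,Sf(t)$. With $x=T\begin{bmatrix}x_{\mathrm{diff}}\\ x_{\mathrm{imp}}\end{bmatrix}$ the system decouples into $\dot x_{\mathrm{diff}}=Jx_{\mathrm{diff}}+f_{\mathrm{diff}}$ and $N\dot x_{\mathrm{imp}}=x_{\mathrm{imp}}+f_{\mathrm{imp}}$; $f_{\mathrm{imp}}$ is required to be $\nu-1$ times piecewise continuously differentiable. Solutions are understood, in general, in the space of piecewise-smooth distributions. The Laplace transform of the solution is $$\hat x(z)=(zE-A)^{-1}(Ex_0+\hat f(z)).$$ Standing assumptions: the finite eigenvalues of $(E,A)$ (those $\lambda\in\mathbb{C}$ with $Av=\lambda Ev$ for some $v\neq0$) have negative real part, i.e.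 all eigenvalues of $J$ have negative real part; the Laplace transform $\hat f$ exists and admits a bounded analytic extension to a suitable region of the complex plane outside the finite eigenvalues of $(E,A)$. The number $\gamma>0$ is the fixed abscissa in the inverse Laplace formula $x(t)=\frac{1}{2\pi\mathbf{i}}\int_{\gamma-\mathbf{i}\infty}^{\gamma+\mathbf{i}\infty}e^{zt}\hat x(z)\,dz$, and the time $t$ is fixed.
   Formalization: The initial value is assumed consistent: a solution x with Ex(0+) = Ex_0 (no impulse at t = 0) exists. Otherwise the claim fails, e.g. f = 0 with N x_imp(0) ≠ 0. *)

(* Defs.v *)
(* MathComp / MathComp-Analysis, over an arbitrary R : realType; complex numbers
   are R[i]. The topology used on R[i] is the one of R[i]^o, i.e. the topology
   of the complex modulus. *)
From HB Require Import structures.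
From mathcomp Require Import all_boot all_order all_algebra.
From mathcomp Require Import complex.
From mathcomp Require Import all_classical all_reals all_analysis.

Set Implicit Arguments.
Unset Strict Implicit.
Unset Printing Implicit Defensive.

Import Order.TTheory GRing.Theory Num.Theory.
Import numFieldNormedType.Exports.

Local Open Scope classical_set_scope.
Local Open Scope complex_scope.
Local Open Scope ring_scope.

Section Complex.
Variable R : realType.
Implicit Types z : R[i].

Definition cmod z : R := Num.sqrt (complex.Re z ^+ 2 + complex.Im z ^+ 2).

Definition cexp z : R[i] :=
  (expR (complex.Re z) * cos (complex.Im z)) +i*
  (expR (complex.Re z) * sin (complex.Im z)).

Definition enorm m (v : 'cV[R[i]]_m) : R := Num.sqrt (\sum_i cmod (v i 0) ^+ 2).

Definition cmx m n (M : 'M[R]_(m, n)) : 'M[R[i]]_(m, n) := map_mx (real_complex R) M.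

Definition Cintegral (D : set R) (h : R -> R[i]) : R[i] :=
  (\int[lebesgue_measure]_(t in D) complex.Re (h t)) +i*
  (\int[lebesgue_measure]_(t in D) complex.Im (h t)).

(* The filter "nrm x --> +oo, with x ranging over D". *)
Definition at_infty (T : Type) (nrm : T -> R) (D : set T) : set_system T :=
  filter_from [set: R] (fun M => [set x | D x /\ M < nrm x]).

Definition analytic_on (D : set R[i]) (g : R[i] -> R[i]) : Prop :=
  forall z0, D z0 -> exists (a : nat -> R[i]) (r : R), 0 < r /\
    forall z, cmod (z - z0) < r ->
      series (fun k => a k * (z - z0) ^+ k : R[i]^o) @ \oo --> (g z : R[i]^o).

End Complex.

Section PiecewiseDistributions.
Variable R : realType.

(* A vector-valued piecewise-regular distribution on the open half-line
   (0, +oo),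
     reg + \sum_tau \sum_k (imp tau)_k * delta_tau^(k),
   where (imp tau)_k is the vector of coefficients of 'X^k in imp tau. Only the
   values at positive times are meaningful. *)
Record pwdist (m : nat) := PWDist {
  reg : R -> 'cV[R]_m ;
  imp : R -> 'cV[{poly R}]_m }.

Definition dist_of m (g : R -> 'cV[R]_m) : pwdist m := PWDist g (fun=> 0).

Definition dmul p m (M : 'M[R]_(p, m)) (D : pwdist m) : pwdist p :=
  PWDist (fun t => M *m reg D t) (fun tau => map_mx polyC M *m imp D tau).

Definition dadd m (D1 D2 : pwdist m) : pwdist m :=
  PWDist (fun t => reg D1 t + reg D2 t) (fun tau => imp D1 tau + imp D2 tau).

Definition entry m (g : R -> 'cV[R]_m) (i : 'I_m) : R -> R := fun t => g t i 0.

Definition jump (g : R -> R) (tau : R) : R := lim (g @ tau^'+) - lim (g @ tau^'-).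

(* Distributional derivative: the pointwise derivative away from the
   breakpoints, a Dirac impulse at each jump, and delta^(k) becoming
   delta^(k+1). At the breakpoints themselves reg (ddt D) is irrelevant. It is
   the derivative in the sense of distributions as soon as D is piecewise
   continuously differentiable. *)
Definition ddt m (D : pwdist m) : pwdist m :=
  PWDist (fun t => \col_i derive1 (entry (reg D) i) t)
         (fun tau => \col_i ((jump (entry (reg D) i) tau)%:P + 'X * imp D tau i 0)).

Definition locally_finite (B : set R) : Prop :=
  forall a b, finite_set (B `&` `[a, b]).

Definition pw_cont m (D : pwdist m) : Prop :=
  [/\ exists B, locally_finite B /\ forall t, 0 < t -> ~ B t ->
        (forall i, {for t, continuous (entry (reg D) i)}) /\ imp D t = 0,
      forall t i, 0 <= t -> cvg (entry (reg D) i @ t^'+) &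
      forall t i, 0 < t -> cvg (entry (reg D) i @ t^'-)].

Definition pw_derivable m (D : pwdist m) : Prop :=
  exists B, locally_finite B /\
    forall t i, 0 < t -> ~ B t -> derivable (entry (reg D) i) t 1.

(* k times piecewise continuously differentiable *)
Fixpoint pwC k m (D : pwdist m) : Prop :=
  if k is k'.+1 then [/\ pw_cont D, pw_derivable D & pwC k' (ddt D)]
  else pw_cont D.

Definition pwd_eq m (D1 D2 : pwdist m) : Prop :=
  (exists B, locally_finite B /\
     forall t, 0 < t -> ~ B t -> reg D1 t = reg D2 t) /\
  (forall tau, 0 < tau -> imp D1 tau = imp D2 tau).

(* The pairing of D with the restriction of exp(-z t) to ]0, b]. Pairing
   delta_tau^(k) with exp(-z t) gives z^k exp(-z tau), so that imp D tau
   contributes its value at z as a polynomial. *)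
Definition trunc_laplace m (D : pwdist m) (z : R[i]) (b : R) (i : 'I_m) : R[i] :=
  Cintegral `]0, b] (fun t => cexp (- (z * t%:C)) * (reg D t i 0)%:C) +
  \sum_(tau \in `]0, b])
     (map_poly (real_complex R) (imp D tau i 0)).[z] * cexp (- (z * tau%:C)).

Definition is_laplace_at m (D : pwdist m) (z : R[i]) (G : 'cV[R[i]]_m) : Prop :=
  forall i, trunc_laplace D z b i @[b --> +oo] --> (G i 0 : R[i]^o).

(* G is the Laplace transform of D, extended analytically to the region Omega:
   the defining integral converges to G on some right half-plane, which lies in
   Omega, and G is analytic on all of Omega. *)
Definition is_laplace m (Omega : set R[i]) (D : pwdist m)
    (G : R[i] -> 'cV[R[i]]_m) : Prop :=
  [/\ forall b i, lebesgue_measure.-integrable `]0, b] (EFin \o entry (reg D) i),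
      exists sigma : R, forall z, sigma < complex.Re z ->
        Omega z /\ is_laplace_at D z (G z) &
      forall i, analytic_on Omega (fun z => G z i 0)].

End PiecewiseDistributions.

Section DAE.
Variable R : realType.

Definition regular_pair n (E A : 'M[R]_n) : Prop :=
  \det ('X *: map_mx polyC E - map_mx polyC A) != 0.

Definition quasi_weierstrass nJ nN (E A S T : 'M[R]_(nJ + nN))
    (J : 'M[R]_nJ) (N : 'M[R]_nN) : Prop :=
  [/\ S \in unitmx, T \in unitmx,
      S *m E *m T = block_mx 1%:M 0 0 N &
      S *m A *m T = block_mx J 0 0 1%:M].

Definition nilpotency_index m (N : 'M[R]_m) (nu : nat) : Prop :=
  N ^+ nu = 0 /\ forall k, (k < nu)%N -> N ^+ k <> 0.

Definition finite_eigenvalue n (E A : 'M[R]_n) (lambda : R[i]) : Prop :=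
  exists v : 'cV[R[i]]_n, v != 0 /\ cmx A *m v = lambda *: (cmx E *m v).

Definition f_diff nJ nN (S : 'M[R]_(nJ + nN)) (f : R -> 'cV[R]_(nJ + nN)) :
  R -> 'cV[R]_nJ := fun t => row_mx 1%:M 0 *m S *m f t.

Definition f_imp nJ nN (S : 'M[R]_(nJ + nN)) (f : R -> 'cV[R]_(nJ + nN)) :
  R -> 'cV[R]_nN := fun t => row_mx 0 1%:M *m S *m f t.

(* x is a (distributional) solution of E x' = A x + f, x(0) = x0, the left-hand
   side being read as (E x)', which makes sense also for the components of x
   that are not differentiated. The solution must start from x0 without Dirac
   impulse at t = 0: reading x0 as the value x(0-), the derivative (E x)' has
   the impulse E (x(0+) - x0) delta_0, which has to vanish. In particular every
   x with x(0+) = x0 qualifies; without this condition on x0 the claim fails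
   (f = 0 and N x_imp(0) != 0). *)
Definition ivp_solution n (E A : 'M[R]_n) (f : R -> 'cV[R]_n) (x0 : 'cV[R]_n)
    (x : pwdist R n) : Prop :=
  [/\ pw_cont x, pw_derivable (dmul E x),
      pwd_eq (ddt (dmul E x)) (dadd (dmul A x) (dist_of f)) &
      forall i, entry (reg (dmul E x)) i t @[t --> 0^'+] --> (E *m x0) i 0].

Definition laplace_solution n (E A : 'M[R]_n) (x0 : 'cV[R]_n)
    (fhat : R[i] -> 'cV[R[i]]_n) (z : R[i]) : 'cV[R[i]]_n :=
  invmx (z *: cmx E - cmx A) *m (cmx E *m cmx x0 + fhat z).

End DAE.

(* Main.v *)
Require Import Defs.
From HB Require Import structures.
From mathcomp Require Import all_boot all_order all_algebra.
From mathcomp Require Import complex.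
From mathcomp Require Import finmap.
From mathcomp Require Import all_classical all_reals all_analysis.
From mathcomp Require Import measurable_realfun ring lra.
Set Implicit Arguments.
Unset Strict Implicit.
Unset Printing Implicit Defensive.
Import Order.TTheory GRing.Theory Num.Theory.
Import numFieldNormedType.Exports.
Local Open Scope classical_set_scope.
Local Open Scope complex_scope.
Local Open Scope ring_scope.

(** In quasi-Weierstrass coordinates y = T^-1 xhat(z), the resolvent equation
  (zE - A) xhat = E x0 + fhat splits into
    z y1 = J y1 + w1   and   z N y2 = y2 + w2,
  where (w1, w2) = S (E x0 + fhat(z)).  Since e^(zt) has constant modulus on
  the line Re z = gamma, it suffices that y1 and y2 tend to 0 there.

  In the first equation w1 is bounded, because fhat is, so that
  |y1| <= |w1| / (|z| - |J|) tends to 0.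

  In the second one N is nilpotent, so y2 is a polynomial in z with
  coefficients involving N^k w2, and a bound on w2 would not do: the growth of
  z^k has to be absorbed by the smoothness of f_imp and by the consistency of
  the initial value.  Write F_k for the transform of the k-th derivative of
  f_imp and c_k for the value of that derivative at 0+.  Two facts are needed.
  - The derivative rule F_(k+1) = z F_k - c_k, on all of Omega
    (laplace_ddt_on).  On a right half-plane it is integration by parts on
    ]0, b], where the jumps of the function account for the Dirac impulses of
    its distributional derivative (by_parts_with_jumps, is_laplace_ddt); the
    identity theorem for analytic functions (analytic_identity) carries it
    over to the connected region Omega, which contains the line.
  - The value of N x_imp at 0 is - \sum_(k < nu - 1) N^(k+1) c_k
    (ivp_initial_value).  Near 0 there is no breakpoint, and there
    N q' = q + f_imp forces N q = - \sum_(1 <= k < nu) N^k f_imp^(k-1).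
  With these, y2 = - \sum_(k < nu) N^k F_k solves the second equation: the
  terms c_k coming from the derivative rule cancel the initial value
  (nilpotent_resolvent).  Every F_k tends to 0, hence so does y2. *)

(** * The fundamental theorem of calculus for piecewise C1 functions *)

Section JumpFTC.
Variable R : realType.
Notation mu := (@lebesgue_measure R).

(** The one-sided limits at a and b extend h and h' continuously to [a, b],
  where the classical theorem applies; changing h' at the two end points does
  not affect the integral. *)
Lemma open_continuous_FTC (h h' : R -> R) (a b ha hb : R) : a < b ->
  (forall t, a < t < b -> is_derive t 1 h (h' t)) ->
  (forall t, a < t < b -> {for t, continuous h'}) ->
  h @ a^'+ --> ha -> h @ b^'- --> hb ->
  cvg (h' @ a^'+) -> cvg (h' @ b^'-) ->
  \int[mu]_(t in `]a, b]) h' t = hb - ha.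
Proof.
move=> ab dh ch' hha hhb cha chb.
(* F and f extend h and h' to [a, b] by their one-sided limits *)
pose F x := if x == a then ha else if x == b then hb else h x.
pose f x := if x == a then lim (h' @ a^'+) else
            if x == b then lim (h' @ b^'-) else h' x.
have in_ab t : a < t < b -> (t == a = false) * (t == b = false).
  by case/andP=> ta tb; rewrite gt_eqF // lt_eqF.
have near_a (k : R -> R) g : (forall t, a < t < b -> k t = g t) ->
    {near a^'+, k =1 g}.
  by move=> kg; near=> t; apply: kg; apply/andP; split.
have near_b (k : R -> R) g : (forall t, a < t < b -> k t = g t) ->
    {near b^'-, k =1 g}.
  by move=> kg; near=> t; apply: kg; apply/andP; split.
have near_t (k : R -> R) g t : (forall t, a < t < b -> k t = g t) ->
    a < t < b -> {near t, k =1 g}.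
  move=> kg abt; have : t \in `]a, b[ by rewrite in_itv.
  move/near_in_itvoo; apply: filterS => u; rewrite in_itv /=; exact: kg.
have hF t : a < t < b -> h t = F t by move=> /in_ab[ta tb]; rewrite /F ta tb.
have hf t : a < t < b -> h' t = f t by move=> /in_ab[ta tb]; rewrite /f ta tb.
have Fa : F a = ha by rewrite /F eqxx.
have Fb : F b = hb by rewrite /F eqxx gt_eqF.
have fa : f a = lim (h' @ a^'+) by rewrite /f eqxx.
have fb : f b = lim (h' @ b^'-) by rewrite /f eqxx gt_eqF.
have -> : \int[mu]_(t in `]a, b]) h' t = \int[mu]_(t in `[a, b]) f t.
  have mh : measurable_fun `]a, b[ h'.
    apply: open_continuous_measurable_fun => // t.
    by rewrite inE /= in_itv => /ch'.
  have mf : measurable_fun `]a, b[ f.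
    by apply: eq_measurable_fun mh => t; rewrite inE /= in_itv /=; exact: hf.
  rewrite /Rintegral (@integral_itv_bndoo _ a b (EFin \o h') false false) /=.
    rewrite (@integral_itv_bndoo _ a b (EFin \o f) true false) /=.
      congr fine; apply: eq_integral => t; rewrite inE /= in_itv /= => /hf.
      by move=> ->.
    exact/measurable_EFinP.
  exact/measurable_EFinP.
rewrite /Rintegral (@continuous_FTC2 _ f F) //; first by rewrite Fa Fb.
- apply/continuous_within_itvP => //; split.
  + move=> t; rewrite in_itv /= => abt; rewrite /continuous_at -hf //.
    apply: cvg_trans (ch' _ abt); apply: near_eq_cvg; exact: near_t abt.
  + rewrite fa; apply: cvg_trans cha; apply: near_eq_cvg; exact: near_a.
  + rewrite fb; apply: cvg_trans chb; apply: near_eq_cvg; exact: near_b.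
- split.
  + move=> t; rewrite in_itv /= => abt.
    by apply: (near_eq_derivable (near_t _ _ _ hF abt)) => //; case: (dh _ abt).
  + rewrite Fa; apply: cvg_trans hha; apply: near_eq_cvg; exact: near_a.
  + rewrite Fb; apply: cvg_trans hhb; apply: near_eq_cvg; exact: near_b.
- move=> t; rewrite in_itv /= => abt.
  rewrite derive1E -hf // -(near_eq_derive _ (near_t _ _ _ hF abt)) //.
  by have [_ ->] := dh _ abt.
Unshelve. all: by end_near. Qed.

Lemma jump_continuous (h : R -> R) t : {for t, continuous h} -> jump h t = 0.
Proof.
move=> ch; rewrite /jump (cvg_lim (@Rhausdorff R) (cvg_at_right_filter ch)).
by rewrite (cvg_lim (@Rhausdorff R) (cvg_at_left_filter ch)) subrr.
Qed.

(** Induction on the number of breakpoints inside ]a, b[, splitting at one of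
  them.  The jump at b is counted and the one at a is not, which makes both
  sides additive under ]a, b] = ]a, c] + ]c, b]. *)
Lemma FTC_with_jumps (h h' : R -> R) (B : set R) (a b : R) : a < b ->
  finite_set (B `&` `]a, b]) ->
  mu.-integrable `]a, b] (EFin \o h') ->
  (forall t, a < t <= b -> ~ B t -> is_derive t 1 h (h' t)) ->
  (forall t, a < t <= b -> ~ B t -> {for t, continuous h'}) ->
  (forall t, a <= t <= b -> cvg (h @ t^'+)) ->
  (forall t, a < t <= b -> cvg (h @ t^'-)) ->
  (forall t, a <= t <= b -> cvg (h' @ t^'+)) ->
  (forall t, a < t <= b -> cvg (h' @ t^'-)) ->
  \int[mu]_(t in `]a, b]) h' t + \sum_(tau \in B `&` `]a, b]) jump h tau =
  lim (h @ b^'+) - lim (h @ a^'+).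
Proof.
move=> ab fB.
have [k] := ubnP #|` fset_set (B `&` `]a, b[)|.
elim: k a b ab fB => // k IH a b ab fB cardB inth' dh ch' hR hL h'R h'L.
have [[c [Bc /=]]|noB] := pselect (exists c, B c /\ c \in `]a, b[); last first.
  have noB' t : a < t < b -> ~ B t.
    by move=> abt Bt; apply: noB; exists t; rewrite in_itv.
  have wt t : a < t < b -> a < t <= b by move=> /andP[-> /ltW].
  have -> : \int[mu]_(t in `]a, b]) h' t = lim (h @ b^'-) - lim (h @ a^'+).
    apply: open_continuous_FTC => //.
    - by move=> t abt; apply: dh; [exact: wt|exact: noB'].
    - by move=> t abt; apply: ch'; [exact: wt|exact: noB'].
    - by apply: hR; rewrite lexx ltW.
    - by apply: hL; rewrite ab lexx.
    - by apply: h'R; rewrite lexx ltW.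
    - by apply: h'L; rewrite ab lexx.
  rewrite (_ : \sum_(_ \in _) _ = jump h b) /jump; first by ring.
  have [Bb|nBb] := pselect (B b).
    rewrite (_ : B `&` _ = [set b]) ?fsbig_set1 //.
    apply/seteqP; split => t /=; last by move=> ->; rewrite in_itv /= ab lexx.
    rewrite in_itv /= => -[Bt /andP[t1]]; rewrite le_eqVlt => /orP[/eqP //|t2].
    by have /noB' : a < t < b by rewrite t1.
  rewrite (_ : B `&` _ = set0).
    rewrite fsbig_set0 -/(jump h b) jump_continuous //.
    apply: differentiable_continuous; apply/derivable1_diffP.
    by have [] := dh b; rewrite ?ab ?lexx.
  apply/seteqP; split => t //=; rewrite in_itv /= => -[Bt /andP[t1]].
  rewrite le_eqVlt => /orP[/eqP tb|t2]; first by apply: nBb; rewrite -tb.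
  by have /noB' : a < t < b by rewrite t1.
rewrite in_itv /= => /andP[ac cb].
have splitE : `]a, b]%classic = `]a, c] `|` `]c, b].
  by rewrite -itv_bndbnd_setU // bnd_simp ltW.
have disj : `]a, c]%classic `&` `]c, b] `<=` set0.
  move=> t /=; rewrite !in_itv /= => -[/andP[_ tc] /andP[]].
  by rewrite ltNge tc.
have fB1 : finite_set (B `&` `]a, c]).
  by apply: sub_finite_set fB; apply: setIS; rewrite splitE; exact: subsetUl.
have fB2 : finite_set (B `&` `]c, b]).
  by apply: sub_finite_set fB; apply: setIS; rewrite splitE; exact: subsetUr.
have i1 : mu.-integrable `]a, c] (EFin \o h').
  by apply: integrableS inth' => //; rewrite splitE; exact: subsetUl.
have i2 : mu.-integrable `]c, b] (EFin \o h').
  by apply: integrableS inth' => //; rewrite splitE; exact: subsetUr.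
rewrite [in X in X + _]splitE Rintegral_setU //; last 2 first.
  by rewrite -splitE.
  by apply/disj_set2P; apply/seteqP; split.
rewrite [in X in _ + X]splitE setIUr fsbigU0 //; last first.
  by move=> t [[_ t1] [_ t2]]; exact: (disj t).
have fBo u v : finite_set (B `&` `]u, v]) -> finite_set (B `&` `]u, v[).
  apply: sub_finite_set; apply: setIS => t /=.
  by rewrite !in_itv /= => /andP[-> /ltW].
have smaller u v : finite_set (B `&` `]u, v]) -> a <= u -> v <= b ->
    ~~ (u < c < v) -> (#|` fset_set (B `&` `]u, v[)| < k)%N.
  move=> fuv au vb cuv; rewrite -ltnS; apply: leq_trans cardB; rewrite ltnS.
  apply: fproper_ltn_card; rewrite fproperE; apply/andP; split.
    apply/fsubsetP => t; rewrite !in_fset_set ?inE; [|exact: fBo..].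
    move=> [Bt] /=; rewrite !in_itv /= => /andP[ut tv]; split=> //.
    by rewrite (le_lt_trans au) // (lt_le_trans tv).
  apply/fsubsetPn; exists c; rewrite in_fset_set ?inE; [|exact: fBo| |exact: fBo].
    by split => //=; rewrite in_itv /= ac cb.
  by apply/negP; rewrite inE /= in_itv /= => -[_]; exact/negP.
have ca t : c <= t <= b -> a < t <= b by move=> /andP[/(lt_le_trans ac) -> ->].
have cW t : c < t <= b -> a < t <= b by move=> /andP[/(lt_trans ac) -> ->].
have aW t : a <= t <= c -> a <= t <= b.
  by move=> /andP[-> tc]; rewrite (le_trans tc) // ltW.
have aW' t : a < t <= c -> a < t <= b.
  by move=> /andP[-> tc]; rewrite (le_trans tc) // ltW.
have wk t : a < t <= b -> a <= t <= b by move=> /andP[/ltW -> ->].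
rewrite addrACA.
transitivity ((lim (h @ c^'+) - lim (h @ a^'+)) +
              (lim (h @ b^'+) - lim (h @ c^'+))); last by ring.
congr (_ + _); apply: IH => //.
- by apply: smaller => //; rewrite ?ltW // ltxx andbF.
- by move=> t /aW'; exact: dh.
- by move=> t /aW'; exact: ch'.
- by move=> t /aW; exact: hR.
- by move=> t /aW'; exact: hL.
- by move=> t /aW; exact: h'R.
- by move=> t /aW'; exact: h'L.
- by apply: smaller => //; rewrite ?ltW // ltxx.
- by move=> t /cW; exact: dh.
- by move=> t /cW; exact: ch'.
- by move=> t /ca/wk; exact: hR.
- by move=> t /cW; exact: hL.
- by move=> t /ca/wk; exact: h'R.
- by move=> t /cW; exact: h'L.
Qed.

End JumpFTC.

(** * The complex modulus and complex limits *)

Section ComplexModulus.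
Variable R : realType.
Implicit Types (z w : R[i]) (r : R).

Lemma cmodE z : (cmod z)%:C = `|z|.
Proof. by rewrite normc_def. Qed.

Lemma cmodM z w : cmod (z * w) = cmod z * cmod w.
Proof. by apply: complexI; rewrite rmorphM /= !cmodE normrM. Qed.

Lemma le_cmodD z w : cmod (z + w) <= cmod z + cmod w.
Proof. by rewrite -lecR rmorphD /= !cmodE ler_normD. Qed.

Lemma cmod_ge0 z : 0 <= cmod z.
Proof. exact: sqrtr_ge0. Qed.

Lemma cmod0 : cmod (0 : R[i]) = 0.
Proof. by apply: complexI; rewrite cmodE normr0. Qed.

Lemma cmodN z : cmod (- z) = cmod z.
Proof. by apply: complexI; rewrite !cmodE normrN. Qed.

Lemma cmodX z n : cmod (z ^+ n) = cmod z ^+ n.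
Proof. by apply: complexI; rewrite rmorphXn /= !cmodE normrX. Qed.

Lemma cmod_real r : cmod r%:C = `|r|.
Proof. by rewrite /cmod /= expr0n /= addr0 sqrtr_sqr. Qed.

Lemma cmod_eq0 z : (cmod z == 0) = (z == 0).
Proof. by rewrite -(inj_eq (@complexI R)) cmodE normr_eq0. Qed.

Lemma cmod_sum (I : Type) (r : seq I) (P : pred I) (F : I -> R[i]) :
  cmod (\sum_(i <- r | P i) F i) <= \sum_(i <- r | P i) cmod (F i).
Proof.
elim/big_ind2: _ => [|u x v y ux vy|//]; first by rewrite cmod0.
by rewrite (le_trans (le_cmodD _ _)) // lerD.
Qed.

Lemma normr_Im_le z : `|complex.Im z| <= cmod z.
Proof. by rewrite -sqrtr_sqr /cmod ler_wsqrtr // lerDr sqr_ge0. Qed.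

(** Limits in the complex topology, whose radii are complex numbers, expressed
  with real radii. *)
Lemma complex_cvgP (T : Type) (F : set_system T) (FF : Filter F)
    (u : T -> R[i]) (l : R[i]) :
  (u x @[x --> F] --> (l : R[i]^o)) <->
  (forall e : R, 0 < e -> \forall x \near F, cmod (u x - l) < e).
Proof.
split=> [ul e e0|H].
  have e0' : 0 < e%:C by rewrite ltcR.
  have /cvgrPdistC_lt /(_ _ e0') : (fun x => u x : R[i]^o) @ F --> (l : R[i]^o).
    exact: ul.
  by apply: filterS => x; rewrite -cmodE ltcR.
apply: (proj2 (@cvgrPdistC_lt R[i] R[i]^o T F FF u l)) => e e0.
have eR : (complex.Re e)%:C = e by apply: RRe_real; exact: gtr0_real.
have /H : 0 < complex.Re e by rewrite -ltcR eR.
by apply: filterS => x; rewrite -ltcR eR cmodE.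
Qed.

End ComplexModulus.

Section ComplexLimits.
Variables (R : realType) (T : Type) (F : set_system T).
Implicit Types (u v : T -> R[i]) (a b : R[i]).

(** The next lemmas fix the topology of R[i]^o on plain functions into R[i], as
  in the definition of the Laplace transform. *)
Lemma complex_cvgD (FF : Filter F) u v a b :
  (u x @[x --> F] --> (a : R[i]^o)) -> (v x @[x --> F] --> (b : R[i]^o)) ->
  u x + v x @[x --> F] --> (a + b : R[i]^o).
Proof. exact: (@cvgD R[i] R[i]^o). Qed.

Lemma complex_cvgM (FF : Filter F) u v a b :
  (u x @[x --> F] --> (a : R[i]^o)) -> (v x @[x --> F] --> (b : R[i]^o)) ->
  u x * v x @[x --> F] --> (a * b : R[i]^o).
Proof. exact: (@cvgM R[i]). Qed.

Lemma complex_cvg_cst (FF : Filter F) a : (a @[x --> F] --> (a : R[i]^o)).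
Proof. exact: (@cvg_cst R[i]^o). Qed.

Lemma complex_cvg_unique (FF : ProperFilter F) u a b :
  (u x @[x --> F] --> (a : R[i]^o)) -> (u x @[x --> F] --> (b : R[i]^o)) -> a = b.
Proof. exact: (@cvg_unique R[i]^o (@norm_hausdorff _ _) (u @ F)). Qed.

End ComplexLimits.

(** * The Laplace kernel *)

Section LaplaceKernel.
Variable R : realType.
Notation mu := (@lebesgue_measure R).
Implicit Types z : R[i].

Definition kernel z (t : R) : R[i] := cexp (- (z * t%:C)).

Lemma kernelE z t : kernel z t =
  (expR (- (complex.Re z * t)) * cos (- (complex.Im z * t))) +i*
  (expR (- (complex.Re z * t)) * sin (- (complex.Im z * t))).
Proof.
case: z => a b; rewrite /kernel.
rewrite (_ : (a +i* b) * t%:C = (a * t) +i* (b * t)) //.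
by apply/eqP; rewrite eq_complex /= !mulr0 subr0 add0r !eqxx.
Qed.

Lemma kernelD z w t : kernel (z + w) t = kernel z t * kernel w t.
Proof.
rewrite !kernelE; case: z w => [a b] [c d] /=.
rewrite !mulrDl !opprD expRD cosD sinD.
apply/eqP; rewrite eq_complex /=; apply/andP; split; apply/eqP; ring.
Qed.

Lemma kernel0 z : kernel z 0 = 1.
Proof. by rewrite kernelE !mulr0 oppr0 expR0 cos0 sin0 mul1r mulr0. Qed.

Lemma cmod_cexp z : cmod (cexp z) = expR (complex.Re z).
Proof.
rewrite /cmod /= !exprMn -mulrDr cos2Dsin2 mulr1 sqrtr_sqr ger0_norm // expR_ge0.
Qed.

Lemma is_derive_kernel_Re z (t : R) :
  is_derive t 1 (fun t => complex.Re (kernel z t))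
                (complex.Re (- z * kernel z t)).
Proof.
under eq_fun do rewrite kernelE /=.
rewrite kernelE; case: z => a b /=.
apply: is_derive_eq; rewrite /GRing.scale /=; ring.
Qed.

Lemma is_derive_kernel_Im z (t : R) :
  is_derive t 1 (fun t => complex.Im (kernel z t))
                (complex.Im (- z * kernel z t)).
Proof.
under eq_fun do rewrite kernelE /=.
rewrite kernelE; case: z => a b /=.
apply: is_derive_eq; rewrite /GRing.scale /=; ring.
Qed.

Lemma continuous_kernel_Re z : continuous (fun t => complex.Re (kernel z t)).
Proof.
move=> t; apply: differentiable_continuous; apply/derivable1_diffP.
by have [] := is_derive_kernel_Re z t.
Qed.

Lemma continuous_kernel_Im z : continuous (fun t => complex.Im (kernel z t)).
Proof.
move=> t; apply: differentiable_continuous; apply/derivable1_diffP.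
by have [] := is_derive_kernel_Im z t.
Qed.

Lemma integrable_continuousM (e g : R -> R) a b : continuous e ->
  mu.-integrable `]a, b] (EFin \o g) ->
  mu.-integrable `]a, b] (EFin \o (fun t => e t * g t)).
Proof.
move=> ce ig.
apply: (@integrableMr _ _ _ mu `]a, b] _ e (EFin \o g)) => //.
  by apply: measurable_funTS; exact: continuous_measurable_fun.
have /compact_bounded [M [Mr HM]] : compact (e @` `[a, b]).
  by apply: continuous_compact; [exact: continuous_subspaceT|exact: segment_compact].
exists M; split => // x Mx t /= ; rewrite in_itv /= => /andP[/ltW at_ tb].
by apply: (HM x Mx); exists t => //=; rewrite in_itv /= at_ tb.
Qed.

End LaplaceKernel.

Arguments kernel : simpl never.

(** * Integration by parts across jumps *)

Section LaplaceByParts.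
Variable R : realType.
Notation mu := (@lebesgue_measure R).
Implicit Types z : R[i].

(** A single exceptional set serves for g and its derivative, so that products
  with smooth weights stay in the class. *)
Definition piecewise_C1 (B : set R) (g g' : R -> R) : Prop :=
  [/\ locally_finite B,
      forall t, 0 < t -> ~ B t ->
        is_derive t 1 g (g' t) /\ {for t, continuous g'},
      forall t, 0 <= t -> cvg (g @ t^'+) /\ cvg (g' @ t^'+) &
      forall t, 0 < t -> cvg (g @ t^'-) /\ cvg (g' @ t^'-)].

Lemma finite_breakpoints (B : set R) (b : R) :
  locally_finite B -> finite_set (B `&` `]0, b]).
Proof.
move=> /(_ 0 b); apply: sub_finite_set; apply: setIS => t /=.
by rewrite !in_itv /= => /andP[/ltW -> ->].
Qed.

Lemma jumpM (e g : R -> R) t : {for t, continuous e} ->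
  cvg (g @ t^'+) -> cvg (g @ t^'-) ->
  jump (fun x => e x * g x) t = e t * jump g t.
Proof.
move=> ce cR cL; rewrite /jump mulrBr.
have eR := cvg_at_right_filter ce.
have eL := cvg_at_left_filter ce.
by rewrite (cvg_lim (@Rhausdorff R) (cvgM eR cR))
  (cvg_lim (@Rhausdorff R) (cvgM eL cL)).
Qed.

(** The product e g has derivative e g' + e' g off B and jumps by e times the
  jump of g, so this is the fundamental theorem with jumps for e g. *)
Lemma by_parts_with_jumps (e e' g g' : R -> R) (B : set R) (b : R) : 0 < b ->
  (forall t : R, is_derive t 1 e (e' t)) -> continuous e' ->
  piecewise_C1 B g g' ->
  mu.-integrable `]0, b] (EFin \o g) -> mu.-integrable `]0, b] (EFin \o g') ->
  \int[mu]_(t in `]0, b]) (e t * g' t) +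
    \sum_(tau \in B `&` `]0, b]) e tau * jump g tau =
  e b * lim (g @ b^'+) - e 0 * lim (g @ 0^'+)
    - \int[mu]_(t in `]0, b]) (e' t * g t).
Proof.
move=> b0 de ce' [fB dg gR gL] ig ig'.
have ce : continuous e.
  move=> t; apply: differentiable_continuous; apply/derivable1_diffP.
  by have [] := de t.
have ie'g := integrable_continuousM ce' ig.
have ieg' := integrable_continuousM ce ig'.
have cg t : 0 < t -> ~ B t -> {for t, continuous g}.
  move=> t0 Bt; apply: differentiable_continuous; apply/derivable1_diffP.
  by have [[]] := dg t t0 Bt.
have eR t := cvg_at_right_filter (ce t).
have eL t := cvg_at_left_filter (ce t).
have e'R t := cvg_at_right_filter (ce' t).
have e'L t := cvg_at_left_filter (ce' t).
have ftc : \int[mu]_(t in `]0, b]) (e t * g' t + e' t * g t) +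
    \sum_(tau \in B `&` `]0, b]) jump (fun t => e t * g t) tau =
    lim ((fun t => e t * g t) @ b^'+) - lim ((fun t => e t * g t) @ 0^'+).
  apply: FTC_with_jumps => //.
  - exact: finite_breakpoints.
  - exact: (integrableD _ ieg' ie'g).
  - move=> t /andP[t0 _] Bt.
    have [dgt _] := dg t t0 Bt; have det := de t.
    by apply: is_derive_eq; rewrite /GRing.scale /= [g t * _]mulrC.
  - move=> t /andP[t0 _] Bt; have [_ cg't] := dg t t0 Bt.
    by apply: cvgD; apply: cvgM; [exact: ce|exact: cg't|exact: ce'|exact: cg].
  - move=> t /andP[t0 _]; apply: is_cvgM; first exact: cvgP (eR t).
    by case: (gR t t0).
  - move=> t /andP[t0 _]; apply: is_cvgM; first exact: cvgP (eL t).
    by case: (gL t t0).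
  - move=> t /andP[t0 _]; have [gt g't] := gR t t0.
    apply: is_cvgD; apply: is_cvgM => //.
      exact: cvgP (eR t).
    exact: cvgP (e'R t).
  - move=> t /andP[t0 _]; have [gt g't] := gL t t0.
    apply: is_cvgD; apply: is_cvgM => //.
      exact: cvgP (eL t).
    exact: cvgP (e'L t).
have jumpE : \sum_(tau \in B `&` `]0, b]) jump (fun t => e t * g t) tau =
    \sum_(tau \in B `&` `]0, b]) e tau * jump g tau.
  apply: eq_fsbigr => t; rewrite inE => -[_ /=]; rewrite in_itv /= => /andP[t0 _].
  by apply: jumpM; [exact: ce|apply: (gR t (ltW t0)).1|apply: (gL t t0).1].
move: ftc; rewrite jumpE RintegralD //.
rewrite (cvg_lim (@Rhausdorff R) (cvgM (eR b) (gR b (ltW b0)).1)).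
rewrite (cvg_lim (@Rhausdorff R) (cvgM (eR 0) (gR 0 (lexx 0)).1)).
by move=> <-; ring.
Qed.

End LaplaceByParts.

Section LaplaceDerivative.
Variable R : realType.
Notation mu := (@lebesgue_measure R).
Implicit Types z : R[i].

Lemma Re_mulrC z (r : R) : complex.Re (z * r%:C) = complex.Re z * r.
Proof. by case: z => a b /=; rewrite mulr0 subr0. Qed.

Lemma Im_mulrC z (r : R) : complex.Im (z * r%:C) = complex.Im z * r.
Proof. by case: z => a b /=; rewrite mulr0 add0r. Qed.

Lemma Re_fsum (A : set R) (F : R -> R[i]) : finite_set A ->
  complex.Re (\sum_(t \in A) F t) = \sum_(t \in A) complex.Re (F t).
Proof.
move=> fA; rewrite !fsbig_finite //=.
by apply: (big_morph (@complex.Re R)) => // -[a b] [c d].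
Qed.

Lemma Im_fsum (A : set R) (F : R -> R[i]) : finite_set A ->
  complex.Im (\sum_(t \in A) F t) = \sum_(t \in A) complex.Im (F t).
Proof.
move=> fA; rewrite !fsbig_finite //=.
by apply: (big_morph (@complex.Im R)) => // -[a b] [c d].
Qed.

Lemma Cintegral_kernelE z (g : R -> R) (A : set R) :
  Cintegral A (fun t => kernel z t * (g t)%:C) =
  (\int[mu]_(t in A) (complex.Re (kernel z t) * g t)) +i*
  (\int[mu]_(t in A) (complex.Im (kernel z t) * g t)).
Proof.
rewrite /Cintegral; congr (_ +i* _); apply: eq_Rintegral => t _.
  by rewrite Re_mulrC.
by rewrite Im_mulrC.
Qed.

(** The real and imaginary parts of exp(-zt) are two real weights to which
  integration by parts applies; their derivatives recombine into
  multiplication by -z. *)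
Lemma laplace_by_parts z (g g' : R -> R) (B : set R) (b : R) : 0 < b ->
  piecewise_C1 B g g' ->
  mu.-integrable `]0, b] (EFin \o g) -> mu.-integrable `]0, b] (EFin \o g') ->
  Cintegral `]0, b] (fun t => kernel z t * (g' t)%:C) +
    \sum_(tau \in B `&` `]0, b]) kernel z tau * (jump g tau)%:C =
  z * Cintegral `]0, b] (fun t => kernel z t * (g t)%:C) +
    kernel z b * (lim (g @ b^'+))%:C - (lim (g @ 0^'+))%:C.
Proof.
move=> b0 pg ig ig'.
have cRe := @continuous_kernel_Re R z.
have cIm := @continuous_kernel_Im R z.
have fB : finite_set (B `&` `]0, b]) by case: pg => /finite_breakpoints.
have iRe := integrable_continuousM cRe ig.
have iIm := integrable_continuousM cIm ig.
have linear_int (p q : R) :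
    \int[mu]_(t in `]0, b])
       ((p * complex.Re (kernel z t) + q * complex.Im (kernel z t)) * g t) =
    p * (\int[mu]_(t in `]0, b]) (complex.Re (kernel z t) * g t)) +
    q * (\int[mu]_(t in `]0, b]) (complex.Im (kernel z t) * g t)).
  have ip := integrable_continuousM (@cst_continuous _ _ p) iRe.
  have iq := integrable_continuousM (@cst_continuous _ _ q) iIm.
  rewrite -!RintegralZl // -RintegralD //.
  by apply: eq_Rintegral => t _; ring.
have ReM t : complex.Re (- z * kernel z t) =
    - complex.Re z * complex.Re (kernel z t) + complex.Im z * complex.Im (kernel z t).
  by move: (kernel z t) => [u v]; case: (z) => a c /=; ring.
have ImM t : complex.Im (- z * kernel z t) =
    - complex.Im z * complex.Re (kernel z t) + (- complex.Re z) * complex.Im (kernel z t).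
  by move: (kernel z t) => [u v]; case: (z) => a c /=; ring.
have cReM : continuous (fun t => complex.Re (- z * kernel z t)).
  under eq_fun do rewrite ReM.
  by move=> t; apply: cvgD; apply: cvgM; [exact: cvg_cst|exact: cRe
    |exact: cvg_cst|exact: cIm].
have cImM : continuous (fun t => complex.Im (- z * kernel z t)).
  under eq_fun do rewrite ImM.
  by move=> t; apply: cvgD; apply: cvgM; [exact: cvg_cst|exact: cRe
    |exact: cvg_cst|exact: cIm].
have bpR := by_parts_with_jumps b0 (@is_derive_kernel_Re R z) cReM pg ig ig'.
have bpI := by_parts_with_jumps b0 (@is_derive_kernel_Im R z) cImM pg ig ig'.
move: bpR bpI.
under [X in _ - X]eq_Rintegral do rewrite ReM.
rewrite linear_int => bpR.
under [X in _ - X]eq_Rintegral do rewrite ImM.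
rewrite linear_int => bpI.
rewrite !Cintegral_kernelE.
set S := \sum_(tau \in _) _.
have SR : complex.Re S =
    \sum_(tau \in B `&` `]0, b]) complex.Re (kernel z tau) * jump g tau.
  by rewrite Re_fsum //; apply: eq_fsbigr => t _; exact: Re_mulrC.
have SI : complex.Im S =
    \sum_(tau \in B `&` `]0, b]) complex.Im (kernel z tau) * jump g tau.
  by rewrite Im_fsum //; apply: eq_fsbigr => t _; exact: Im_mulrC.
move: bpR bpI; rewrite -SR -SI kernel0; cbv beta.
move: (\int[mu]_(t in _) (complex.Re (kernel z t) * g t)) => iR.
move: (\int[mu]_(t in _) (complex.Im (kernel z t) * g t)) => iI.
move: (\int[mu]_(t in _) (complex.Re (kernel z t) * g' t)) => iR'.
move: (\int[mu]_(t in _) (complex.Im (kernel z t) * g' t)) => iI'.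
move: (kernel z b) S {SR SI} => [u v] [sR sI].
case: (z) => a c /= bpR bpI.
apply/eqP; rewrite eq_complex /= bpR bpI.
by apply/andP; split; apply/eqP; ring.
Qed.

(** An impulse delta^(k) becomes delta^(k+1), which multiplies its contribution
  by z, and the impulses created at the jumps are exactly the jump terms of
  the integration by parts. *)
Lemma trunc_laplace_ddt m (D : pwdist R m) (i : 'I_m) z (b : R) : 0 < b ->
  pwC 1 D ->
  mu.-integrable `]0, b] (EFin \o entry (reg D) i) ->
  mu.-integrable `]0, b] (EFin \o entry (reg (ddt D)) i) ->
  trunc_laplace (ddt D) z b i = z * trunc_laplace D z b i +
    kernel z b * (lim (entry (reg D) i @ b^'+))%:C -
    (lim (entry (reg D) i @ 0^'+))%:C.
Proof.
move=> b0 [[[B1 [fB1 cD]] DR DL] [B2 [fB2 dD]] [[B3 [fB3 cD']] D'R D'L]] ig ig'.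
pose B := B1 `|` B2 `|` B3.
have fB : locally_finite B.
  by move=> u v; rewrite /B !setIUl !finite_setU; split => //; split.
have nB t : ~ B t -> [/\ ~ B1 t, ~ B2 t & ~ B3 t].
  by move=> nBt; split => Bt; apply: nBt; [left; left|left; right|right].
have pg : piecewise_C1 B (entry (reg D) i) (entry (reg (ddt D)) i).
  split => //.
  - move=> t t0 /nB[n1 n2 n3]; split; last exact: (cD' t t0 n3).1.
    by rewrite /entry /= mxE derive1E; apply: DeriveDef => //; exact: dD.
  - by move=> t t0; split; [exact: DR|exact: D'R].
  - by move=> t t0; split; [exact: DL|exact: D'L].
have fBb := finite_breakpoints b fB.
have := laplace_by_parts z b0 pg ig ig'.
rewrite /trunc_laplace -!/(kernel _ _) => ibp.
have on_B (F : R -> R[i]) : (forall t, 0 < t -> ~ B t -> F t = 0) ->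
    \sum_(t \in `]0, b]) F t = \sum_(t \in B `&` `]0, b]) F t.
  move=> F0; apply/esym/fsbig_widen; first exact: subIsetr.
  move=> t [/= t0b nBt]; apply: F0; first by move: t0b; rewrite in_itv /= => /andP[].
  by move=> Bt; apply: nBt.
rewrite !on_B; last 2 first.
- by move=> t t0 /nB[n1 _ _]; rewrite (cD t t0 n1).2 mxE raddf0 horner0 mul0r.
- by move=> t t0 /nB[_ _ n3]; rewrite (cD' t t0 n3).2 mxE raddf0 horner0 mul0r.
pose P := \sum_(t \in B `&` `]0, b])
  (map_poly (real_complex R) (imp D t i 0)).[z] * cexp (- (z * t%:C)).
rewrite -/P.
have -> : \sum_(t \in B `&` `]0, b])
    (map_poly (real_complex R) (imp (ddt D) t i 0)).[z] * cexp (- (z * t%:C)) =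
    \sum_(t \in B `&` `]0, b]) kernel z t * (jump (entry (reg D) i) t)%:C +
    z * P.
  rewrite mulr_fsumr -fsbig_split //=; apply: eq_fsbigr => t _.
  rewrite mxE rmorphD rmorphM /= map_polyC map_polyX hornerD hornerC hornerM hornerX.
  by rewrite mulrDl mulrA [_%:C * _]mulrC.
by rewrite addrA ibp mulrDr /kernel; ring.
Qed.

End LaplaceDerivative.

Section LaplaceRule.
Variable R : realType.
Notation mu := (@lebesgue_measure R).

Lemma kernel_cvg0 (r : R) : 0 < r ->
  kernel r%:C b @[b --> +oo] --> (0 : R[i]^o).
Proof.
move=> r0; apply/complex_cvgP => e e0.
have : expR (- (r * b)) @[b --> +oo] --> (0 : R).
  apply: (@cvg_comp _ _ _ (fun b => r * b) (fun b => expR (- b)) _ (pinfty_nbhs R)).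
    by apply: gt0_cvgMry => //; exact: cvg_id.
  exact: cvgr_expR.
move=> /cvgrPdistC_lt /(_ e e0); apply: filterS => b.
rewrite !subr0 ger0_norm ?expR_ge0 // /kernel cmod_cexp.
by rewrite -rmorphM -rmorphN.
Qed.

(** Letting b tend to infinity in trunc_laplace_ddt, the boundary term
  exp(-zb) g(b+) has a limit because all other terms do.  It also has a limit
  at z - d, for d > 0 small, and its value at z is exp(-db) times its value at
  z - d; so the limit at z is 0. *)
Lemma is_laplace_ddt m (Omega : set R[i]) (D : pwdist R m)
    (G G' : R[i] -> 'cV[R[i]]_m) :
  pwC 1 D -> is_laplace Omega D G -> is_laplace Omega (ddt D) G' ->
  exists sigma : R, forall z, sigma < complex.Re z -> Omega z /\
    forall i, G' z i 0 = z * G z i 0 - (lim (entry (reg D) i @ 0^'+))%:C.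
Proof.
move=> pD [ig [s1 HG] _] [ig' [s2 HG'] _].
have FF : ProperFilter (pinfty_nbhs R) by exact: proper_pinfty_nbhs.
exists (Num.max s1 s2) => z; rewrite gt_max => /andP[zs1 zs2].
split=> [|i]; first by have [] := HG z zs1.
pose c : R[i] := (lim (entry (reg D) i @ 0^'+))%:C.
pose v w (b : R) : R[i] := kernel w b * (lim (entry (reg D) i @ b^'+))%:C.
pose L w : R[i] := G' w i 0 - w * G w i 0 + c.
have vL w : s1 < complex.Re w -> s2 < complex.Re w ->
    v w b @[b --> +oo] --> (L w : R[i]^o).
  move=> ws1 ws2.
  have [_ /(_ i) lG] := HG w ws1; have [_ /(_ i) lG'] := HG' w ws2.
  have zG := complex_cvgM FF (complex_cvg_cst FF (a := - w)) lG.
  have := complex_cvgD FF (complex_cvgD FF lG' zG) (complex_cvg_cst FF (a := c)).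
  rewrite mulNr -/(L w); apply: cvg_trans; apply: near_eq_cvg.
  near=> b; rewrite trunc_laplace_ddt //.
  by rewrite /v /c; ring.
(* the boundary term at z is exp(-db) times a convergent one *)
have [d [d0 d1 d2]] : exists d : R,
    [/\ 0 < d, s1 < complex.Re z - d & s2 < complex.Re z - d].
  exists ((complex.Re z - Num.max s1 s2) / 2).
  have [] : s1 <= Num.max s1 s2 /\ s2 <= Num.max s1 s2 by rewrite !le_max !lexx orbT.
  have : Num.max s1 s2 < complex.Re z by rewrite gt_max zs1.
  by move: (Num.max s1 s2) => s *; split; lra.
have Re_shift : complex.Re (z - d%:C) = complex.Re z - d by case: (z).
have : v z b @[b --> +oo] --> (0 * L (z - d%:C) : R[i]^o).
  have -> : v z = fun b => kernel d%:C b * v (z - d%:C) b.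
    by apply/funext => b; rewrite /v mulrA -kernelD addrC subrK.
  apply: (complex_cvgM FF (kernel_cvg0 d0)).
  by apply: vL; rewrite Re_shift.
rewrite mul0r => /(complex_cvg_unique FF (vL z zs1 zs2)); rewrite /L => L0.
by rewrite -/c -[LHS]subr0 -L0; ring.
Unshelve. all: by end_near. Qed.

End LaplaceRule.

(** * The Laplace transform of a linear image *)

Section LaplaceLinear.
Variable R : realType.
Notation mu := (@lebesgue_measure R).

Lemma complex_cvg_sum (T : Type) (F : set_system T) (FF : Filter F)
    (I : Type) (r : seq I) (u : I -> T -> R[i]) (a : I -> R[i]) :
  (forall i, u i x @[x --> F] --> (a i : R[i]^o)) ->
  \sum_(i <- r) u i x @[x --> F] --> (\sum_(i <- r) a i : R[i]^o).
Proof.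
move=> ua; elim: r => [|i r IH].
  rewrite big_nil; under eq_fun do rewrite big_nil.
  exact: (complex_cvg_cst FF (a := 0)).
rewrite big_cons; under eq_fun do rewrite big_cons.
exact: (complex_cvgD FF (ua i) IH).
Qed.

Lemma RintegralM_sum (e : R -> R) (I : Type) (r : seq I) (c : I -> R)
    (g : I -> R -> R) (b : R) : continuous e ->
  (forall i, mu.-integrable `]0, b] (EFin \o g i)) ->
  \int[mu]_(t in `]0, b]) (e t * \sum_(i <- r) c i * g i t) =
  \sum_(i <- r) c i * \int[mu]_(t in `]0, b]) (e t * g i t).
Proof.
move=> ce ig.
have icg i : mu.-integrable `]0, b] (EFin \o (fun t => c i * (e t * g i t))).
  apply: (integrable_continuousM (@cst_continuous _ _ (c i))).
  exact: integrable_continuousM.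
have : mu.-integrable `]0, b]
    (EFin \o (fun t => e t * \sum_(i <- r) c i * g i t)) /\
  \int[mu]_(t in `]0, b]) (e t * \sum_(i <- r) c i * g i t) =
  \sum_(i <- r) c i * \int[mu]_(t in `]0, b]) (e t * g i t); last by case.
elim: r => [|i r [IH1 IH2]].
  have -> : (fun t => e t * \sum_(i <- [::]) c i * g i t) = (fun=> 0).
    by apply/funext => t; rewrite big_nil mulr0.
  by rewrite big_nil /Rintegral integral0; split => //; exact: integrable0.
have -> : (fun t => e t * \sum_(j <- i :: r) c j * g j t) =
    (fun t => c i * (e t * g i t) + e t * \sum_(j <- r) c j * g j t).
  by apply/funext => t; rewrite big_cons; ring.
rewrite big_cons; split; first exact: (integrableD _ (icg i) IH1).
rewrite RintegralD // IH2 RintegralZl //.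
exact: integrable_continuousM.
Qed.

Lemma trunc_laplace_dist_of m (f : R -> 'cV[R]_m) z b i :
  trunc_laplace (dist_of f) z b i =
  Cintegral `]0, b] (fun t => kernel z t * (f t i 0)%:C).
Proof.
rewrite /trunc_laplace [X in _ + X]fsbig1 ?addr0 // => t _.
by rewrite mxE raddf0 horner0 mul0r.
Qed.

Lemma trunc_laplace_mulmx p m (M : 'M[R]_(p, m)) (f : R -> 'cV[R]_m) z b i :
  (forall j, mu.-integrable `]0, b] (EFin \o entry f j)) ->
  trunc_laplace (dist_of (fun t => M *m f t)) z b i =
  \sum_j (M i j)%:C * trunc_laplace (dist_of f) z b j.
Proof.
move=> intf; rewrite trunc_laplace_dist_of Cintegral_kernelE.
under eq_Rintegral do rewrite mxE.
under [X in _ +i* X]eq_Rintegral do rewrite mxE.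
rewrite (RintegralM_sum _ _ (@continuous_kernel_Re R z) intf).
rewrite (RintegralM_sum _ _ (@continuous_kernel_Im R z) intf).
under [RHS]eq_bigr => j _ do rewrite trunc_laplace_dist_of Cintegral_kernelE mulrC.
apply/eqP; rewrite eq_complex; apply/andP; split; apply/eqP => /=.
  rewrite (big_morph (@complex.Re R) (id1 := 0) (op1 := +%R)) //; last by case=> ? ? [].
  by apply: eq_bigr => j _; rewrite Re_mulrC mulrC.
rewrite (big_morph (@complex.Im R) (id1 := 0) (op1 := +%R)) //; last by case=> ? ? [].
by apply: eq_bigr => j _; rewrite Im_mulrC mulrC.
Qed.

Lemma is_laplace_mulmx p m (Omega : set R[i]) (M : 'M[R]_(p, m))
    (f : R -> 'cV[R]_m) (G : R[i] -> 'cV[R[i]]_m) (G' : R[i] -> 'cV[R[i]]_p) :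
  is_laplace Omega (dist_of f) G ->
  is_laplace Omega (dist_of (fun t => M *m f t)) G' ->
  exists sigma : R, forall z, sigma < complex.Re z ->
    Omega z /\ G' z = cmx M *m G z.
Proof.
move=> [ig [s1 HG] _] [_ [s2 HG'] _].
have FF : ProperFilter (pinfty_nbhs R) by exact: proper_pinfty_nbhs.
exists (Num.max s1 s2) => z; rewrite gt_max => /andP[zs1 zs2].
have [Oz lG] := HG z zs1; have [_ lG'] := HG' z zs2.
split=> //; apply/colP => i; rewrite mxE.
apply: (complex_cvg_unique FF (lG' i)).
under eq_fun do rewrite trunc_laplace_mulmx //.
under eq_bigr do rewrite mxE.
by apply: complex_cvg_sum => j;
  exact: (complex_cvgM FF (complex_cvg_cst FF (a := (M i j)%:C)) (lG j)).
Qed.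

End LaplaceLinear.

(** * The identity theorem for analytic functions *)

Section IdentityTheorem.
Variable R : realType.
Implicit Types (z w : R[i]) (a : nat -> R[i]) (g : R[i] -> R[i]).

Lemma complex_nbhsP z (A : set R[i]) :
  nbhs (z : R[i]^o) A <->
  exists2 r : R, 0 < r & forall w, cmod (w - z) < r -> A w.
Proof.
split.
  move=> /(@nbhs_normP R[i] R[i]^o) [e /= e0 eA].
  have eR : (complex.Re e)%:C = e by apply: RRe_real; exact: gtr0_real.
  exists (complex.Re e) => [|w]; first by rewrite -ltcR eR.
  rewrite -ltcR eR cmodE => zw; apply: eA.
  by rewrite /ball_ /= distrC.
move=> [r r0 rA]; apply/(@nbhs_normP R[i] R[i]^o); exists r%:C; first by rewrite /= ltcR.
by move=> w; rewrite /ball_ /= distrC -cmodE ltcR => /rA.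
Qed.

(** A term is the difference of two consecutive partial sums, and these are
  bounded. *)
Lemma pseries_bounded a (rho : R) (l : R[i]) : 0 < rho ->
  (series (fun k => a k * (rho%:C) ^+ k : R[i]^o) @ \oo --> (l : R[i]^o)) ->
  exists2 M : R, 0 < M & forall k, cmod (a k) * rho ^+ k <= M.
Proof.
move=> rho0 cvS.
have /(@cvg_seq_bounded R[i] R[i]^o) [M0 [M0r HM]] :
  cvgn (series (fun k => a k * (rho%:C) ^+ k : R[i]^o)) by apply: cvgP cvS.
pose M1 := complex.Re M0 + 1.
have M1gt : M0 < M1%:C by rewrite /M1 rmorphD /= RRe_real // ltrDl ltr01.
have HS n : cmod (series (fun k => a k * (rho%:C) ^+ k : R[i]^o) n) <= M1.
  by rewrite -lecR cmodE; apply: HM.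
exists (M1 + M1 + 1) => [|k].
  by rewrite ltr_wpDl // addr_ge0 // (le_trans _ (HS 0%N)) // cmod_ge0.
apply: (@le_trans _ _ (M1 + M1)); last by rewrite lerDl.
have -> : cmod (a k) * rho ^+ k = cmod (a k * (rho%:C) ^+ k).
  by rewrite cmodM cmodX cmod_real gtr0_norm.
have := HS k.+1; rewrite seriesSr.
have := HS k.
set s := series _ k; set u := a k * _ => sM suM.
rewrite (_ : u = (s + u) - s); last by rewrite addrAC subrr add0r.
by rewrite (le_trans (le_cmodD _ _)) // cmodN lerD.
Qed.

Lemma geometric_sum_le2 (q : R) n : 0 <= q -> q <= 2^-1 ->
  \sum_(0 <= k < n) q ^+ k <= 2.
Proof.
move=> q0 q2; suff: \sum_(0 <= k < n) q ^+ k + 2 * q ^+ n <= 2.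
  by apply: le_trans; rewrite lerDl mulr_ge0 // exprn_ge0.
elim: n => [|n IH]; first by rewrite big_geq // add0r expr0 mulr1.
rewrite big_nat_recr //= exprS; have := exprn_ge0 n q0; nra.
Qed.

(** At a zero w the tail of the series, which is O(|w|), has to compensate a 0;
  letting w tend to 0 gives a 0 = 0. *)
Lemma pseries_coef0 a (rho M : R) : 0 < rho -> 0 < M ->
  (forall k, cmod (a k) * rho ^+ k <= M) ->
  (forall e : R, 0 < e -> exists w, [/\ w != 0, cmod w < e &
     series (fun k => a k * w ^+ k : R[i]^o) @ \oo --> (0 : R[i]^o)]) ->
  a 0%N = 0.
Proof.
move=> rho0 M0 aM zeros; apply/eqP; rewrite -cmod_eq0.
apply: contraT => a0; have {}a0 : 0 < cmod (a 0%N) by rewrite lt0r a0 cmod_ge0.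
(* for |w| < e the tail of the series is smaller than |a 0| / 2 *)
pose e := Num.min (rho / 2) (rho * cmod (a 0%N) / (4 * M + 1)).
have e0 : 0 < e.
  rewrite lt_min !divr_gt0 ?mulr_gt0 //=.
  by rewrite ltr_wpDl // mulr_ge0 // ltW.
have [w [w0 we /complex_cvgP H]] := zeros e e0.
have [N _ /(_ N.+1 (leqnSn N)) /=] := H _ (divr_gt0 a0 (ltr0Sn _ 1)).
rewrite subr0 /series /= big_nat_recl // expr0 mulr1 => small.
pose q := cmod w / rho.
have q0 : 0 <= q by rewrite divr_ge0 ?cmod_ge0 // ltW.
have [w2 wM] : cmod w < rho / 2 /\ cmod w < rho * cmod (a 0%N) / (4 * M + 1).
  by move: we; rewrite lt_min => /andP[].
have q2 : q <= 2^-1 by rewrite ler_pdivrMr // mulrC ltW.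
have qM : 4 * M * q < cmod (a 0%N).
  have M1 : 0 < 4 * M + 1 by rewrite ltr_wpDl // mulr_ge0 // ltW.
  rewrite mulrA ltr_pdivrMr //; move: wM; rewrite ltr_pdivlMr //.
  by have := cmod_ge0 w; nra.
set s := \sum_(0 <= k < N) _ in small.
have sle : cmod s <= 2 * M * q.
  rewrite (le_trans (cmod_sum _ _ _)) //.
  apply: (@le_trans _ _ (\sum_(0 <= k < N) M * q * q ^+ k)).
    apply: ler_sum => k _; rewrite cmodM cmodX.
    have -> : cmod w ^+ k.+1 = rho ^+ k.+1 * q ^+ k.+1.
      by rewrite -exprMn /q mulrC divfK // gt_eqF.
    by rewrite -[X in _ <= X]mulrA -exprS mulrA ler_wpM2r ?exprn_ge0.
  rewrite -mulr_sumr.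
  have := geometric_sum_le2 N q0 q2.
  by have := mulr_ge0 (ltW M0) q0; set S := \sum_(_ <= _ < _) _; nra.
have : cmod (a 0%N) <= cmod (a 0%N + s) + cmod s.
  rewrite -(cmodN s); apply: le_trans (le_cmodD _ _).
  by rewrite addrK.
lra.
Qed.

(** Once a 0 = 0, dividing by w shows that the shifted series has the same
  nonzero zeros, so the vanishing of the first coefficient propagates. *)
Lemma pseries_zeros a (rho M : R) : 0 < rho -> 0 < M ->
  (forall k, cmod (a k) * rho ^+ k <= M) ->
  (forall e : R, 0 < e -> exists w, [/\ w != 0, cmod w < e &
     series (fun k => a k * w ^+ k : R[i]^o) @ \oo --> (0 : R[i]^o)]) ->
  forall k, a k = 0.
Proof.
move=> rho0 M0 aM zeros k; elim: k a M M0 aM zeros => [|k IH] a M M0 aM zeros.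
  exact: pseries_coef0 aM zeros.
have a0 := pseries_coef0 rho0 M0 aM zeros.
apply: (IH (fun k => a k.+1) (M / rho)); first exact: divr_gt0.
  by move=> j; rewrite ler_pdivlMr // -mulrA -exprSr.
move=> e /zeros[w [w0 we cvS]]; exists w; split => //.
have FF : ProperFilter \oo by exact: eventually_filter.
have -> : series (fun k => a k.+1 * w ^+ k : R[i]^o) =
    fun n => w^-1 * series (fun k => a k * w ^+ k : R[i]^o) n.+1.
  apply/funext => n; rewrite /series /= big_nat_recl // a0 mul0r add0r mulr_sumr.
  apply: eq_bigr => j _; rewrite exprS mulrCA (mulrA _ w) mulVf //.
  by rewrite mul1r.
rewrite -[X in _ --> X](mulr0 w^-1).
apply: (complex_cvgM FF (complex_cvg_cst FF (a := w^-1))).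
by rewrite (cvg_shiftS (series (fun k => a k * w ^+ k : R[i]^o))).
Qed.

End IdentityTheorem.

Section AnalyticFunctions.
Variable R : realType.
Implicit Types (z w : R[i]) (g h : R[i] -> R[i]) (Omega : set R[i]).

Let FF : ProperFilter (@eventually). Proof. exact: eventually_filter. Qed.

Lemma analytic_cst Omega (c : R[i]) : analytic_on Omega (fun=> c).
Proof.
move=> z0 _; exists (fun k => if k is 0%N then c else 0), 1; split=> [|z _]; first exact: ltr01.
have : (fun n => if n is 0%N then 0 else c) @ \oo --> (c : R[i]^o).
  rewrite -(cvg_shiftS (fun n => if n is 0%N then 0 else c : R[i]^o)) /=.
  exact: (complex_cvg_cst FF (a := c)).
apply: cvg_trans; apply: near_eq_cvg; near=> n.
rewrite /series /=; case: (n) => [|j]; first by rewrite big_geq.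
by rewrite big_nat_recl // expr0 mulr1 big1 ?addr0 // => i _; rewrite mul0r.
Unshelve. all: by end_near. Qed.

Lemma analytic_add_scale Omega g h (c : R[i]) :
  analytic_on Omega g -> analytic_on Omega h ->
  analytic_on Omega (fun z => g z + c * h z).
Proof.
move=> ag ah z0 Oz.
have [a [r [r0 ga]]] := ag z0 Oz; have [b [s [s0 hb]]] := ah z0 Oz.
exists (fun k => a k + c * b k), (Num.min r s); split; first by rewrite lt_min r0.
move=> z; rewrite lt_min => /andP[zr zs].
have := complex_cvgD FF (ga z zr) (complex_cvgM FF (complex_cvg_cst FF (a := c)) (hb z zs)).
apply: cvg_trans; apply: near_eq_cvg; near=> n.
rewrite /series /= mulr_sumr -big_split /=; apply: eq_bigr => k _.
by rewrite mulrDl mulrA.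
Unshelve. all: by end_near. Qed.

Lemma analytic_mulz Omega g :
  analytic_on Omega g -> analytic_on Omega (fun z => z * g z).
Proof.
move=> ag z0 Oz; have [a [r [r0 ga]]] := ag z0 Oz.
exists (fun k => z0 * a k + if k is j.+1 then a j else 0), r.
split=> [|z zr]; first exact: r0.
rewrite -(cvg_shiftS (series _)).
have gS : series (fun k => a k * (z - z0) ^+ k : R[i]^o) n.+1 @[n --> \oo]
    --> (g z : R[i]^o).
  by rewrite (cvg_shiftS (series (fun k => a k * (z - z0) ^+ k : R[i]^o))); exact: ga.
have := complex_cvgD FF (complex_cvgM FF (complex_cvg_cst FF (a := z0)) gS)
   (complex_cvgM FF (complex_cvg_cst FF (a := z - z0)) (ga z zr)).
rewrite (_ : z0 * g z + (z - z0) * g z = z * g z); last by ring.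
apply: cvg_trans; apply: near_eq_cvg; near=> n.
rewrite /series /= !mulr_sumr.
under [RHS]eq_bigr do rewrite mulrDl.
rewrite big_split /=; congr (_ + _).
  by apply: eq_bigr => k _; rewrite mulrA.
rewrite [RHS]big_nat_recl // mul0r add0r; apply: eq_bigr => k _.
by rewrite exprS mulrCA.
Unshelve. all: by end_near. Qed.

Lemma analytic_sum Omega (I : Type) (r : seq I) (c : I -> R[i]) (h : I -> R[i] -> R[i]) :
  (forall i, analytic_on Omega (h i)) ->
  analytic_on Omega (fun z => \sum_(i <- r) c i * h i z).
Proof.
move=> ah; elim: r => [|i r IH].
  under eq_fun do rewrite big_nil.
  exact: analytic_cst.
under eq_fun do rewrite big_cons addrC.
by have := @analytic_add_scale Omega _ _ (c i) IH (ah i).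
Qed.

(** The set of points near which g vanishes is open, is nonempty as it contains
  a point of the half-plane, and is closed in Omega because at a limit
  point the zeros of g accumulate, which kills the power series there. *)
Lemma analytic_identity Omega g (sigma : R) :
  connected (Omega : set R[i]^o) -> analytic_on Omega g ->
  (forall z, sigma < complex.Re z -> Omega z /\ g z = 0) ->
  forall z, Omega z -> g z = 0.
Proof.
move=> connO ag g0 z Oz.
pose C := [set z | exists2 r : R, 0 < r & forall w, cmod (w - z) < r -> g w = 0].
have C0 u : C u -> g u = 0 by move=> [r r0]; apply; rewrite subrr cmod0.
suff CO : Omega `&` C = Omega.
  by have [_ /C0] : (Omega `&` C) z by rewrite CO.
apply: connO.
- have Reg (u : R) : complex.Re (u%:C : R[i]) = u by [].
  exists (sigma + 1)%:C; split => /=; first by apply: (g0 _ _).1; rewrite /= ltrDl.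
  exists 1 => // w; case: w => u v uv; apply: (g0 _ _).2 => /=.
  have : `|u - (sigma + 1)| < 1.
    apply: le_lt_trans uv; rewrite -lecR cmodE.
    by have := normc_ge_Re ((u +i* v) - (sigma + 1)%:C).
  by rewrite ltr_norml; lra.
- exists C => //; rewrite openE => u [r r0 rg]; apply/complex_nbhsP.
  exists (r / 2) => [|w wu]; first exact: divr_gt0.
  exists (r / 2) => [|v vw]; first exact: divr_gt0.
  apply: rg; rewrite -(subrK w v) -addrA.
  by rewrite (le_lt_trans (le_cmodD _ _)) // [r]splitr ltrD.
- exists (closure (C : set R[i]^o)); first exact: closed_closure.
  apply/seteqP; split => u [Ou Cu]; split => //; first exact: subset_closure.
  have [a [r [r0 ga]]] := ag u Ou.
  have [//|nCu] := pselect (C u).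
  have cv v : cmod (v - u) < r / 2 + r / 2 ->
     series (fun k => a k * (v - u) ^+ k : R[i]^o) @ \oo --> (g v : R[i]^o).
    by rewrite -splitr; exact: ga.
  have r2 : 0 < r / 2 by exact: divr_gt0.
  have cvr : series (fun k => a k * ((r / 2)%:C) ^+ k : R[i]^o) @ \oo -->
      (g (u + (r / 2)%:C) : R[i]^o).
    have := cv (u + (r / 2)%:C); rewrite addrAC subrr add0r; apply.
    by rewrite cmod_real gtr0_norm // ltrDl.
  have [M M0 aM] := pseries_bounded r2 cvr.
  have a0 : forall k, a k = 0.
    apply: (pseries_zeros r2 M0 aM) => e e0.
    have [] := Cu [set w | cmod (w - u) < Num.min e r].
      by apply/complex_nbhsP; exists (Num.min e r); rewrite ?lt_min ?e0.
    move=> w [Cw /=]; rewrite lt_min => /andP[we wr].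
    exists (w - u); split; [|exact: we|by rewrite -(C0 w Cw); exact: ga].
    by rewrite subr_eq0; apply/eqP => wu; apply: nCu; rewrite -wu.
  exists r => // w wr.
  apply: (complex_cvg_unique FF (ga w wr)).
  have := complex_cvg_cst FF (a := 0 : R[i]).
  apply: cvg_trans; apply: near_eq_cvg; near=> n.
  by rewrite /series /= big1 // => k _; rewrite a0 mul0r.
Unshelve. all: by end_near. Qed.

End AnalyticFunctions.

(** * The initial value of the algebraic part *)

Section VectorDerivatives.
Variable R : realType.

(** Everything that concerns the initial value happens on an interval ]0, eps[
  free of breakpoints, on which distributions are ordinary functions. *)
Definition has_derivative_near0 (eps : R) m (u v : R -> 'cV[R]_m) : Prop :=
  forall t : R, 0 < t < eps -> forall i, is_derive t 1 (entry u i) (v t i 0).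

Lemma is_derive_lincomb (I : Type) (r : seq I) (c : I -> R) (u : I -> R -> R)
    (v : I -> R) (t : R) :
  (forall i, is_derive t 1 (u i) (v i)) ->
  is_derive t 1 (fun x => \sum_(i <- r) c i * u i x) (\sum_(i <- r) c i * v i).
Proof.
move=> uv; elim: r => [|i r IH].
  by under eq_fun do rewrite big_nil; rewrite big_nil; exact: is_derive_cst.
under eq_fun do rewrite big_cons; rewrite big_cons.
have h := uv i.
by apply: is_derive_eq.
Qed.

Lemma cvg_lincomb (F : set_system R) (FF : Filter F) (I : Type) (r : seq I)
    (c : I -> R) (u : I -> R -> R) (l : I -> R) :
  (forall i, u i @ F --> l i) ->
  \sum_(i <- r) c i * u i x @[x --> F] --> \sum_(i <- r) c i * l i.
Proof.
move=> ul; elim: r => [|i r IH].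
  by under eq_fun do rewrite big_nil; rewrite big_nil; exact: cvg_cst.
under eq_fun do rewrite big_cons; rewrite big_cons.
by apply: cvgD => //; apply: cvgM => //; exact: cvg_cst.
Qed.

Lemma has_derivative_mulmx eps p m (M : 'M[R]_(p, m)) u v :
  has_derivative_near0 eps u v ->
  has_derivative_near0 eps (fun t => M *m u t) (fun t => M *m v t).
Proof.
move=> uv t teps i; rewrite mxE.
rewrite (_ : entry _ i = fun x => \sum_j M i j * entry u j x); last first.
  by apply/funext => x; rewrite /entry mxE.
by apply: is_derive_lincomb => j; exact: uv.
Qed.

Lemma entry_mulmx_cvg (F : set_system R) (FF : Filter F) p m (M : 'M[R]_(p, m))
    (u : R -> 'cV[R]_m) (l : 'cV[R]_m) :
  (forall i, entry u i @ F --> l i 0) ->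
  forall i, entry (fun t => M *m u t) i @ F --> (M *m l) i 0.
Proof.
move=> ul i; rewrite mxE.
rewrite (_ : entry _ i = fun x => \sum_j M i j * entry u j x); last first.
  by apply/funext => x; rewrite /entry mxE.
by apply: cvg_lincomb.
Qed.

Lemma has_derivative_unique eps m (u1 u2 v1 v2 : R -> 'cV[R]_m) :
  has_derivative_near0 eps u1 v1 -> has_derivative_near0 eps u2 v2 ->
  (forall t, 0 < t < eps -> u1 t = u2 t) ->
  forall t, 0 < t < eps -> v1 t = v2 t.
Proof.
move=> d1 d2 u12 t teps; apply/colP => i.
have u12t : \near t, entry u1 i t = entry u2 i t.
  have : t \in `]0, eps[ by rewrite in_itv.
  move/near_in_itvoo; apply: filterS => x; rewrite in_itv /= => /u12.
  by rewrite /entry => ->.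
have [_ <-] := d1 t teps i; have [_ <-] := d2 t teps i.
exact: near_eq_derive.
Qed.

Lemma has_derivativeW eps eps' m (u v : R -> 'cV[R]_m) : eps' <= eps ->
  has_derivative_near0 eps u v -> has_derivative_near0 eps' u v.
Proof.
by move=> le_eps uv t /andP[t0 te]; apply: uv; rewrite t0 (lt_le_trans te).
Qed.

Lemma locally_finite_gap (B : set R) : locally_finite B ->
  exists2 eps : R, 0 < eps & forall t, 0 < t < eps -> ~ B t.
Proof.
move=> fB; pose S := (B `&` `[0, 1]) `\ 0.
have fS : finite_set S by apply: sub_finite_set (fB 0 1); exact: subDsetl.
have : closed S by exact: (accessible_finite_set_closed.1 (hausdorff_accessible (@Rhausdorff R))).
move=> /closed_openC; rewrite openE => /(_ 0) /= [].
  by move=> [_]; apply.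
move=> e /= e0 eS; exists (Num.min e 1); first by rewrite lt_min e0 ltr01.
move=> t /andP[t0]; rewrite lt_min => /andP[te t1] Bt.
apply: (eS t); first by rewrite /= sub0r normrN gtr0_norm.
by split => [|/= t00]; [split => //=; rewrite in_itv /= !ltW|move: t0; rewrite t00 ltxx].
Qed.

Lemma pw_derivable_near0 m (D : pwdist R m) : pw_derivable D ->
  exists2 eps : R, 0 < eps & has_derivative_near0 eps (reg D) (reg (ddt D)).
Proof.
move=> [B [/locally_finite_gap[eps e0 nB] dD]]; exists eps => // t teps i.
rewrite mxE derive1E; apply: DeriveDef => //.
by apply: dD; [case/andP: teps|exact: nB].
Qed.

Lemma pwC_derivable_near0 k m (D : pwdist R m) : pwC k D ->
  exists2 eps : R, 0 < eps & forall j, (j < k)%N ->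
    has_derivative_near0 eps (reg (iter j (@ddt R m) D))
                             (reg (iter j.+1 (@ddt R m) D)).
Proof.
elim: k D => [|k IH] D; first by exists 1.
move=> [_ /pw_derivable_near0[e1 e10 d1] /IH[e2 e20 d2]].
exists (Num.min e1 e2); first by rewrite lt_min e10.
move=> [|j] jk; first by apply: has_derivativeW d1; rewrite ge_min lexx.
have := d2 j jk; rewrite -!iterSr.
by apply: has_derivativeW; rewrite ge_min lexx orbT.
Qed.

Lemma pwC_iter k m (D : pwdist R m) j : (j <= k)%N -> pwC k D ->
  pwC (k - j) (iter j (@ddt R m) D).
Proof.
elim: j k D => [|j IH] [|k] D //; rewrite ltnS => jk [_ _ pD].
by rewrite subSS iterSr; exact: IH.
Qed.

Lemma pwC_cont k m (D : pwdist R m) : pwC k D -> pw_cont D.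
Proof. by case: k => [|k] // []. Qed.

End VectorDerivatives.

Section ConsistentInitialValue.
Variable R : realType.

Lemma has_derivative_Nsum eps m n (u v : 'I_n -> R -> 'cV[R]_m) :
  (forall j, has_derivative_near0 eps (u j) (v j)) ->
  has_derivative_near0 eps (fun t => - \sum_j u j t) (fun t => - \sum_j v j t).
Proof.
move=> uv t teps i.
rewrite (_ : entry _ i = fun x => \sum_j (-1) * entry (u j) i x); last first.
  apply/funext => x; rewrite /entry mxE summxE -mulr_sumr mulN1r.
  by congr (- _).
have -> : (- \sum_j v j t) i 0 = \sum_j (-1) * v j t i 0.
  by rewrite mxE summxE -mulr_sumr mulN1r.
by apply: is_derive_lincomb => j; exact: uv.
Qed.

(** Descending induction on the power of N, which is nu - m: differentiating the
  formula for N^(k+1) q and using (N q)' = q + F 0 gives the one for N^k q.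
  The last case, m = nu - 1, expresses N q by F. *)
Lemma nilpotent_dae_solution p nu (N : 'M[R]_p) (eps : R) (q : R -> 'cV[R]_p)
    (F : nat -> R -> 'cV[R]_p) : N ^+ nu = 0 ->
  has_derivative_near0 eps (fun t => N *m q t) (fun t => q t + F 0%N t) ->
  (forall j, (j < nu.-1)%N -> has_derivative_near0 eps (F j) (F j.+1)) ->
  forall m, (m <= nu.-1)%N -> forall t, 0 < t < eps ->
  N ^+ (nu - m) *m q t = - \sum_(j < m) N ^+ (nu - m + j) *m F j t.
Proof.
move=> Nnu dNq dF; elim=> [|m IH] m_lt t teps.
  by rewrite subn0 Nnu mul0mx big_ord0 oppr0.
have [k nuE] : exists k, (nu - m = k.+1)%N.
  by exists (nu - m).-1; rewrite prednK // subn_gt0; case: (nu) m_lt => // n /ltnW.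
have -> : (nu - m.+1 = k)%N by rewrite subnS nuE.
have NkN s : N ^+ k.+1 *m q s = N ^+ k *m (N *m q s).
  by rewrite exprSr -mulmxE mulmxA.
have dl := has_derivative_mulmx (N ^+ k) dNq.
have dr : has_derivative_near0 eps
    (fun t => - \sum_(j < m) N ^+ (k.+1 + j) *m F j t)
    (fun t => - \sum_(j < m) N ^+ (k.+1 + j) *m F j.+1 t).
  apply: has_derivative_Nsum => j; apply: has_derivative_mulmx.
  by apply: dF; rewrite (ltn_trans (ltn_ord j)).
have lr s : 0 < s < eps ->
    N ^+ k *m (N *m q s) = - \sum_(j < m) N ^+ (k.+1 + j) *m F j s.
  by move=> seps; rewrite -NkN -nuE; apply: IH => //; exact: ltnW.
have := has_derivative_unique dl dr lr teps.
rewrite mulmxDr => Nkq.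
rewrite -[LHS](addrK (N ^+ k *m F 0%N t)) Nkq big_ord_recl addn0 opprD addrC.
by congr (_ - _); apply: eq_bigr => j _; rewrite /= /bump addnS.
Qed.

(** This is the limit at 0+ of the formula for N q. *)
Lemma nilpotent_dae_consistency p nu (N : 'M[R]_p) (eps : R) (q : R -> 'cV[R]_p)
    (F : nat -> R -> 'cV[R]_p) (c : nat -> 'cV[R]_p) (p0 : 'cV[R]_p) :
  N ^+ nu = 0 -> 0 < eps ->
  has_derivative_near0 eps (fun t => N *m q t) (fun t => q t + F 0%N t) ->
  (forall j, (j < nu.-1)%N -> has_derivative_near0 eps (F j) (F j.+1)) ->
  (forall j, (j < nu.-1)%N -> forall i, entry (F j) i @ 0^'+ --> c j i 0) ->
  (forall i, entry (fun t => N *m q t) i @ 0^'+ --> p0 i 0) ->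
  p0 = - \sum_(j < nu.-1) N ^+ j.+1 *m c j.
Proof.
move=> Nnu eps0 dNq dF cF cp0.
case: nu Nnu dF cF => [|nu] Nnu dF cF.
  by rewrite big_ord0 oppr0 -[p0]mul1mx (_ : 1%:M = N ^+ 0) // Nnu mul0mx.
have sol := nilpotent_dae_solution Nnu dNq dF (leqnn _).
apply/colP => i; apply: (@cvg_unique _ (@Rhausdorff R) _ _ _ _ (cp0 i)).
have -> : (- \sum_(j < nu) N ^+ j.+1 *m c j) i 0 =
    \sum_(j < nu) (-1) * (N ^+ j.+1 *m c j) i 0.
  by rewrite mxE summxE -mulr_sumr mulN1r.
have : (fun t => \sum_(j < nu) (-1) * entry (fun t => N ^+ j.+1 *m F j t) i t)
    @ 0^'+ --> \sum_(j < nu) (-1) * (N ^+ j.+1 *m c j) i 0.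
  apply: cvg_lincomb => j; apply: entry_mulmx_cvg; exact: cF.
apply: cvg_trans; apply: near_eq_cvg; near=> t.
have teps : 0 < t < eps by apply/andP; split.
have := sol t teps; rewrite subSnn expr1 /entry => ->.
by rewrite mxE summxE -mulr_sumr mulN1r.
Unshelve. all: by end_near. Qed.

(** The initial condition fixes the limit at 0+ of E x, that is, of N q where
  q is the algebraic component of x; the solution formula for the nilpotent
  part determines that same limit from f_imp. *)
Lemma ivp_initial_value nJ nN nu (E A S T : 'M[R]_(nJ + nN)) (J : 'M[R]_nJ)
    (N : 'M[R]_nN) (f : R -> 'cV[R]_(nJ + nN)) (x0 : 'cV[R]_(nJ + nN))
    (x : pwdist R (nJ + nN)) :
  quasi_weierstrass E A S T J N -> N ^+ nu = 0 ->
  pwC nu.-1 (dist_of (f_imp S f)) -> ivp_solution E A f x0 x ->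
  row_mx 0 1%:M *m S *m (E *m x0) =
  - \sum_(j < nu.-1) N ^+ j.+1 *m
      \col_i lim (entry (reg (iter j (@ddt R nN) (dist_of (f_imp S f)))) i @ 0^'+).
Proof.
move=> [Su Tu ET AT] Nnu pf [_ dEx [[B [fB eqB]] _] Ex0].
pose P := row_mx (0 : 'M[R]_(nN, nJ)) 1%:M *m S.
pose q t := row_mx (0 : 'M[R]_(nN, nJ)) 1%:M *m invmx T *m reg x t.
have PE : P *m E = N *m (row_mx 0 1%:M *m invmx T).
  rewrite -[E](mulmxK Tu) !mulmxA -(mulmxA _ S) -(mulmxA _ _ T) ET.
  by rewrite mul_row_block !mul0mx !mul1mx !add0r mul_mx_row mulmx0 mulmx1.
have PA : P *m A = row_mx 0 1%:M *m invmx T.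
  rewrite -[A](mulmxK Tu) !mulmxA -(mulmxA _ S) -(mulmxA _ _ T) AT.
  by rewrite mul_row_block !mul0mx !mul1mx !add0r.
have [e1 e10 d1] := pw_derivable_near0 dEx.
have [e2 e20 noB] := locally_finite_gap fB.
have [e3 e30 d3] := pwC_derivable_near0 pf.
pose eps := Num.min e1 (Num.min e2 e3).
have [le1 le2 le3] : [/\ eps <= e1, eps <= e2 & eps <= e3].
  by rewrite /eps !ge_min !lexx !orbT.
have NqE t : N *m q t = P *m (E *m reg x t) by rewrite !mulmxA PE !mulmxA.
have qE t : q t = P *m (A *m reg x t) by rewrite !mulmxA PA.
pose D j := iter j (@ddt R nN) (dist_of (f_imp S f)).
apply: (nilpotent_dae_consistency (nu := nu) (eps := eps) (q := q)
  (F := fun j => reg (D j)) (c := fun j => \col_i lim (entry (reg (D j)) i @ 0^'+))) => //.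
- by rewrite !lt_min e10 e20.
- have := has_derivativeW le1 (has_derivative_mulmx P d1).
  move=> d t teps i; rewrite (_ : (fun t => N *m q t) = (fun t => P *m (E *m reg x t))).
    have := d t teps i; congr (is_derive _ _ _ (_ i 0)).
    have [t0 te] := andP teps.
    have /= -> := eqB t t0 (noB t _); last by rewrite t0 (lt_le_trans te).
    by rewrite mulmxDr qE.
  by apply/funext => s; exact: NqE.
- by move=> j j_lt; apply: has_derivativeW le3 (d3 j j_lt).
- move=> j j_lt i; rewrite mxE.
  by have [_ + _] := pwC_cont (pwC_iter (ltnW j_lt) pf); apply.
- rewrite (_ : (fun t => N *m q t) = (fun t => P *m (E *m reg x t))).
    by apply: entry_mulmx_cvg; exact: Ex0.
  by apply/funext => s; exact: NqE.
Qed.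

End ConsistentInitialValue.

(** * Norm and resolvent estimates *)

Section L1Norm.
Variable R : realType.

(** The triangle inequality for this norm needs no Cauchy-Schwarz inequality,
  and it is equivalent to the Euclidean norm. *)
Definition l1norm m (v : 'cV[R[i]]_m) : R := \sum_i cmod (v i 0).

Lemma l1norm_ge0 m (v : 'cV[R[i]]_m) : 0 <= l1norm v.
Proof. by apply: sumr_ge0 => i _; exact: cmod_ge0. Qed.

Lemma l1normD m (u v : 'cV[R[i]]_m) : l1norm (u + v) <= l1norm u + l1norm v.
Proof.
by rewrite -big_split; apply: ler_sum => i _; rewrite mxE; exact: le_cmodD.
Qed.

Lemma l1normN m (u : 'cV[R[i]]_m) : l1norm (- u) = l1norm u.
Proof. by apply: eq_bigr => i _; rewrite mxE cmodN. Qed.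

Lemma l1normZ m (a : R[i]) (v : 'cV[R[i]]_m) :
  l1norm (a *: v) = cmod a * l1norm v.
Proof. by rewrite mulr_sumr; apply: eq_bigr => i _; rewrite mxE cmodM. Qed.

Lemma l1norm_sum m n (u : 'I_n -> 'cV[R[i]]_m) :
  l1norm (\sum_j u j) <= \sum_j l1norm (u j).
Proof.
elim/big_ind2: _ => [|x a y b xa yb|//].
  by rewrite /l1norm big1 // => i _; rewrite mxE cmod0.
by rewrite (le_trans (l1normD _ _)) // lerD.
Qed.

Lemma l1norm_mulmx p m (M : 'M[R[i]]_(p, m)) :
  exists2 K : R, 0 <= K & forall v, l1norm (M *m v) <= K * l1norm v.
Proof.
exists (\sum_i \sum_j cmod (M i j)) => [|v].
  by do 2!apply: sumr_ge0 => ? _; exact: cmod_ge0.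
rewrite mulr_suml; apply: ler_sum => i _; rewrite mxE.
rewrite (le_trans (cmod_sum _ _ _)) // mulr_suml; apply: ler_sum => j _.
rewrite cmodM ler_wpM2l ?cmod_ge0 //.
by rewrite /l1norm (bigD1 j) //= lerDl sumr_ge0 // => k _; exact: cmod_ge0.
Qed.

Lemma cmod_le_enorm m (v : 'cV[R[i]]_m) i : cmod (v i 0) <= enorm v.
Proof.
rewrite -[leLHS]ger0_norm ?cmod_ge0 // -sqrtr_sqr ler_wsqrtr //.
by rewrite (bigD1 i) //= lerDl sumr_ge0 // => j _; exact: sqr_ge0.
Qed.

Lemma l1norm_le_enorm m (v : 'cV[R[i]]_m) : l1norm v <= m%:R * enorm v.
Proof.
rewrite -[m in m%:R]card_ord mulr_natl -sumr_const; apply: ler_sum => i _.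
exact: cmod_le_enorm.
Qed.

Lemma enorm_le_l1norm m (v : 'cV[R[i]]_m) : enorm v <= l1norm v.
Proof.
rewrite -[leRHS]ger0_norm ?l1norm_ge0 // -sqrtr_sqr ler_wsqrtr //.
rewrite expr2 mulr_suml; apply: ler_sum => i _.
rewrite expr2 ler_wpM2l ?cmod_ge0 //.
by rewrite /l1norm (bigD1 i) //= lerDl sumr_ge0 // => j _; exact: cmod_ge0.
Qed.

Lemma l1norm_col_mx m n (u : 'cV[R[i]]_m) (v : 'cV[R[i]]_n) :
  l1norm (col_mx u v) = l1norm u + l1norm v.
Proof.
rewrite /l1norm big_split_ord /=; congr (_ + _); apply: eq_bigr => i _.
  by rewrite col_mxEu.
by rewrite col_mxEd.
Qed.

End L1Norm.

Section Resolvent.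
Variable R : realType.

Lemma mulmx_exprS (K : pzRingType) p (N : 'M[K]_p) k : N *m N ^+ k = N ^+ k.+1.
Proof. by rewrite exprS. Qed.

Lemma cmxM m n p (M : 'M[R]_(m, n)) (M' : 'M[R]_(n, p)) :
  cmx (M *m M') = cmx M *m cmx M'.
Proof. exact: map_mxM. Qed.

Lemma cmxX m (M : 'M[R]_m) k : cmx (M ^+ k) = cmx M ^+ k.
Proof.
elim: k => [|k IH]; first by rewrite !expr0; exact: map_mx1.
by rewrite !exprS -!mulmxE cmxM IH.
Qed.

Lemma pencil_unitmx n (E A : 'M[R]_n) (z : R[i]) :
  (forall lambda, finite_eigenvalue E A lambda -> complex.Re lambda < 0) ->
  0 < complex.Re z -> z *: cmx E - cmx A \in unitmx.
Proof.
move=> eig z0; rewrite unitmxE unitfE -det_tr; apply/det0P => -[v v0 vM].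
have /eig : finite_eigenvalue E A z; last by rewrite ltNge ltW.
exists v^T; split.
  by apply: contra v0 => /eqP vT; rewrite -(trmxK v) vT trmx0.
apply/eqP; rewrite eq_sym -subr_eq0 scalemxAl -mulmxBl.
by rewrite -(trmxK (_ - _)) -trmx_mul vM trmx0.
Qed.

(** The right-hand side solves z N u - u = w: applying z N and replacing z F_k by
  F_(k+1) + c_k shifts the sum, and the c_k reproduce the second part of w.
  The solution is unique, since d = z N d implies d = z^nu N^nu d = 0. *)
Lemma nilpotent_resolvent p nu (N : 'M[R[i]]_p) (z : R[i]) (y w : 'cV[R[i]]_p)
    (F c : nat -> 'cV[R[i]]_p) :
  N ^+ nu = 0 -> z *: (N *m y) - y = w ->
  ((0 < nu)%N -> w = F 0%N - \sum_(k < nu.-1) N ^+ k.+1 *m c k) ->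
  (forall k, (k < nu.-1)%N -> F k.+1 = z *: F k - c k) ->
  y = - \sum_(k < nu) N ^+ k *m F k.
Proof.
move=> Nnu yw wE FE; apply/eqP; rewrite -subr_eq0 opprK; apply/eqP.
set d := y + _.
(* d is the difference of two solutions *)
suff Nd : z *: (N *m d) = d.
  have Nkd k : z ^+ k *: (N ^+ k *m d) = d.
    elim: k => [|k IH]; first by rewrite !expr0 scale1r mul1mx.
    rewrite -[in RHS]Nd -[in RHS]IH -scalemxAr scalerA -exprS mulmxA.
    by rewrite mulmx_exprS.
  by rewrite -(Nkd nu) Nnu mul0mx scaler0.
(* for nu = 0 the space is trivial, as N^0 = 1 vanishes *)
case: nu Nnu wE FE @d => [|nu] Nnu wE FE d.
  have z0 (u : 'cV[R[i]]_p) : u = 0.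
    by rewrite -[u]mul1mx (_ : 1%:M = N ^+ 0) // Nnu mul0mx.
  by rewrite [d]z0 mulmx0 scaler0.
move: yw; rewrite wE //= => /eqP; rewrite subr_eq => /eqP yw.
set C := \sum_(k < nu) N ^+ k.+1 *m c k in yw.
pose S1 := \sum_(k < nu) N ^+ k.+1 *m F k.+1.
have dE : \sum_(k < nu.+1) N ^+ k *m F k = F 0%N + S1.
  by rewrite big_ord_recl /= expr0 mul1mx.
have NdE : z *: (N *m \sum_(k < nu.+1) N ^+ k *m F k) = S1 + C.
  rewrite big_ord_recr /= mulmxDr mulmxA mulmx_exprS Nnu mul0mx.
  rewrite addr0 mulmx_sumr scaler_sumr -big_split /=; apply: eq_bigr => k _.
  rewrite -mulmxDr FE // subrK mulmxA mulmx_exprS.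
  exact: scalemxAr.
rewrite /d mulmxDr scalerDr yw NdE dE.
by rewrite [_ + y]addrC -addrA; congr (_ + _); rewrite [S1 + C]addrC addrA subrK.
Qed.

End Resolvent.

(** * Limits at infinity and Laplace rules on the whole region *)

Section AtInfinity.
Variables (R : realType) (T : Type) (nrm : T -> R) (D : set T).

Lemma at_infty_filter : Filter (at_infty nrm D).
Proof.
apply: filter_from_filter; first by exists 0.
move=> M1 M2 _ _; exists (Num.max M1 M2) => // x [Dx].
by rewrite gt_max => /andP[].
Qed.

Lemma at_infty_cvg0P (u : T -> R) :
  u @ at_infty nrm D --> (0 : R) <->
  forall e : R, 0 < e -> exists M : R, forall x, D x -> M < nrm x -> `|u x| < e.
Proof.
have FF := at_infty_filter.
split=> [u0 e e0|H].
  have := (cvgrPdistC_lt u 0).1 u0 e e0 => -[M _ HM].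
  by exists M => x Dx Mx; have /= := HM x (conj Dx Mx); rewrite subr0.
apply/cvgrPdistC_lt => e /H[M HM]; exists M => // x [Dx Mx] /=.
by rewrite subr0; exact: HM.
Qed.

End AtInfinity.

Section LaplaceOnRegion.
Variable R : realType.

(** The rule extends from a half-plane to Omega by analytic continuation. *)
Lemma laplace_ddt_on m (Omega : set R[i]) (D : pwdist R m)
    (G G' : R[i] -> 'cV[R[i]]_m) :
  connected (Omega : set R[i]^o) -> pwC 1 D ->
  is_laplace Omega D G -> is_laplace Omega (ddt D) G' ->
  forall z, Omega z ->
  G' z = z *: G z - cmx (\col_i lim (entry (reg D) i @ 0^'+)).
Proof.
move=> connO pD LG LG' z Oz; apply/colP => i; rewrite !mxE.
have [sigma H] := is_laplace_ddt pD LG LG'.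
have [_ _ anG] := LG; have [_ _ anG'] := LG'.
pose c : R[i] := (lim (entry (reg D) i @ 0^'+))%:C.
have an := analytic_add_scale (-1)
  (analytic_add_scale 1 (anG' i) (@analytic_cst _ _ c)) (analytic_mulz (anG i)).
have := @analytic_identity _ _ _ sigma connO an _ z Oz.
rewrite mul1r mulN1r -/c => E; apply/eqP; rewrite -subr_eq0; apply/eqP.
apply: (etrans _ (E _)); first by rewrite -/c; ring.
by move=> s /H[Os Gs]; split => //; rewrite Gs -/c; ring.
Qed.

Lemma laplace_mulmx_on p m (Omega : set R[i]) (M : 'M[R]_(p, m))
    (f : R -> 'cV[R]_m) (G : R[i] -> 'cV[R[i]]_m) (G' : R[i] -> 'cV[R[i]]_p) :
  connected (Omega : set R[i]^o) ->
  is_laplace Omega (dist_of f) G ->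
  is_laplace Omega (dist_of (fun t => M *m f t)) G' ->
  forall z, Omega z -> G' z = cmx M *m G z.
Proof.
move=> connO LG LG' z Oz; apply/colP => i; rewrite !mxE.
have [sigma H] := is_laplace_mulmx LG LG'.
have [_ _ anG] := LG; have [_ _ anG'] := LG'.
have an := analytic_add_scale (-1) (anG' i)
  (analytic_sum (index_enum 'I_m) (fun j => cmx M i j) anG).
have := @analytic_identity _ _ _ sigma connO an _ z Oz.
rewrite mulN1r => E; apply/eqP; rewrite -subr_eq0; apply/eqP; apply: E.
by move=> s /H[Os ->]; split => //; rewrite mxE mulN1r subrr.
Qed.

Lemma pwC1 k m (D : pwdist R m) : (0 < k)%N -> pwC k D -> pwC 1 D.
Proof. by case: k => // k _ [cD dD /pwC_cont cdD]; split. Qed.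

Lemma weierstrass_resolvent nJ nN (E A S T : 'M[R]_(nJ + nN)) (J : 'M[R]_nJ)
    (N : 'M[R]_nN) (z : R[i]) (x w : 'cV[R[i]]_(nJ + nN)) :
  quasi_weierstrass E A S T J N -> (z *: cmx E - cmx A) *m x = w ->
  let y := cmx (invmx T) *m x in
  [/\ x = cmx T *m y,
      z *: usubmx y - cmx J *m usubmx y = usubmx (cmx S *m w) &
      z *: (cmx N *m dsubmx y) - dsubmx y = cmx (row_mx 0 1%:M *m S) *m w].
Proof.
move=> [Su Tu ET AT] xw y.
have xE : x = cmx T *m y by rewrite /y mulmxA -cmxM mulmxV // /cmx map_mx1 mul1mx.
have SwE : cmx S *m w = (z *: cmx (block_mx 1%:M 0 0 N) -
    cmx (block_mx J 0 0 1%:M)) *m y.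
  rewrite -xw xE -ET -AT !cmxM mulmxA mulmxA; congr (_ *m _).
  by rewrite mulmxBr mulmxBl -scalemxAr -scalemxAl.
have {}SwE : cmx S *m w = col_mx
    (z *: usubmx y - cmx J *m usubmx y)
    (z *: (cmx N *m dsubmx y) - dsubmx y).
  rewrite SwE -[y in LHS]vsubmxK /cmx !map_block_mx !map_mx0 !map_mx1.
  rewrite mulmxBl -scalemxAl !mul_block_col !mul0mx !mul1mx !addr0 !add0r.
  by rewrite scale_col_mx opp_col_mx add_col_mx.
split => //; first by rewrite SwE col_mxKu.
rewrite cmxM -mulmxA SwE /cmx map_row_mx map_mx0 map_mx1 mul_row_col.
by rewrite mul0mx mul1mx add0r.
Qed.

End LaplaceOnRegion.

(** * Decay along the vertical line *)

Theorem theorem2p6 (R : realType) (nJ nN nu : nat)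
    (E A S T : 'M[R]_(nJ + nN)) (J : 'M[R]_nJ) (N : 'M[R]_nN)
    (f : R -> 'cV[R]_(nJ + nN)) (x0 : 'cV[R]_(nJ + nN))
    (x : pwdist R (nJ + nN))
    (Omega : set R[i])
    (fhat : R[i] -> 'cV[R[i]]_(nJ + nN))
    (fdiffhat : R[i] -> 'cV[R[i]]_nJ)
    (fimphat : nat -> R[i] -> 'cV[R[i]]_nN)
    (gamma t alpha C : R)
    (regEA : regular_pair E A)
    (qwf : quasi_weierstrass E A S T J N)
    (indexN : nilpotency_index N nu)
    (eigEA : forall lambda, finite_eigenvalue E A lambda -> complex.Re lambda < 0)
    (f_imp_smooth : pwC nu.-1 (dist_of (f_imp S f)))
    (solx : ivp_solution E A f x0 x)
    (openO : open (Omega : set R[i]^o))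
    (connO : connected (Omega : set R[i]^o))
    (eigO : forall lambda, finite_eigenvalue E A lambda -> ~ Omega lambda)
    (gamma_gt0 : 0 < gamma)
    (lineO : forall omega : R, Omega (gamma +i* omega))
    (Lf : is_laplace Omega (dist_of f) fhat)
    (fhat_bounded : exists M : R, forall z, Omega z -> enorm (fhat z) <= M)
    (Lf_diff : is_laplace Omega (dist_of (f_diff S f)) fdiffhat)
    (Lf_imp : forall j, (j < nu)%N ->
      is_laplace Omega (iter j (@ddt R nN) (dist_of (f_imp S f))) (fimphat j))
    (alpha_lt1 : alpha < 1)
    (growth_diff :
      (limf_esup (fun z : R[i]^o => (enorm (fdiffhat z) / cmod z `^ alpha)%:E)
         (at_infty (@cmod R) Omega) <= C%:E)%E)
    (decay_imp : forall j, (j < nu)%N ->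
      (fun z => enorm (fimphat j z)) @ at_infty (@cmod R) Omega --> (0 : R)) :
  (fun omega : R => enorm (cexp ((gamma +i* omega) * t%:C) *:
                             laplace_solution E A x0 fhat (gamma +i* omega)))
    @ at_infty (fun omega : R => `|omega|) setT --> (0 : R).

Proof.
case: (indexN) => Nnu _.
pose z omega : R[i] := gamma +i* omega.
pose w omega := cmx E *m cmx x0 + fhat (z omega).
pose y omega := cmx (invmx T) *m laplace_solution E A x0 fhat (z omega).
pose D j := iter j (@ddt R nN) (dist_of (f_imp S f)).
pose c j := cmx (\col_i lim (entry (reg (D j)) i @ 0^'+)).
have FF : Filter (at_infty (fun omega : R => `|omega|) setT).
  exact: at_infty_filter.
have solve omega : (z omega *: cmx E - cmx A) *m
    laplace_solution E A x0 fhat (z omega) = w omega.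
  rewrite /laplace_solution mulmxA mulmxV ?mul1mx //.
  exact: pencil_unitmx eigEA _.
have lap_rule k omega : (k < nu.-1)%N ->
    fimphat k.+1 (z omega) = z omega *: fimphat k (z omega) - c k.
  move=> k_lt; have kS_lt : (k.+1 < nu)%N by case: (nu) k_lt.
  have Dk_C1 : pwC 1 (D k).
    apply: (@pwC1 _ (nu.-1 - k)); first by rewrite subn_gt0.
    exact: pwC_iter (ltnW k_lt) f_imp_smooth.
  exact: (laplace_ddt_on connO Dk_C1 (Lf_imp k (ltnW kS_lt)) (Lf_imp k.+1 kS_lt)
            (lineO omega)).
have lap0 omega : (0 < nu)%N ->
    fimphat 0%N (z omega) = cmx (row_mx 0 1%:M *m S) *m fhat (z omega).
  by move=> nu_gt0; exact: (laplace_mulmx_on connO Lf (Lf_imp 0%N nu_gt0) (lineO omega)).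
have y2E omega : dsubmx (y omega) =
    - \sum_(k < nu) cmx N ^+ k *m fimphat k (z omega).
  have [_ _ y2_eq] := weierstrass_resolvent qwf (solve omega).
  apply: (nilpotent_resolvent (F := fun k => fimphat k (z omega))
    (c := c) _ y2_eq) => [|nu_gt0|k].
  - by rewrite -cmxX Nnu /cmx map_mx0.
  - rewrite /w mulmxDr -lap0 // addrC; congr (_ + _).
    rewrite -!cmxM (ivp_initial_value qwf Nnu f_imp_smooth solx).
    rewrite /cmx map_mxN map_mx_sum; congr (- _); apply: eq_bigr => k _.
    by rewrite /c -cmxX -cmxM.
  - exact: lap_rule.
have [KT KT0 HKT] := l1norm_mulmx (cmx T).
have [KJ KJ0 HKJ] := l1norm_mulmx (cmx J).
have [KS KS0 HKS] := l1norm_mulmx (cmx S).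
have /choice[K HK] : forall k, exists K : R, 0 <= K /\
    forall v, l1norm (cmx N ^+ k *m v) <= K * l1norm v.
  by move=> k; have [K K0 HK] := l1norm_mulmx (cmx N ^+ k); exists K.
have [M HM] := fhat_bounded.
pose W := KS * (l1norm (cmx E *m cmx x0) + (nJ + nN)%:R * M).
(* z y1 = J y1 + w1 with |w1| <= W gives |y1| (|z| - KJ) <= W *)
have y1_le omega : KJ < `|omega| -> l1norm (usubmx (y omega)) <= W / (`|omega| - KJ).
  move=> KJ_lt; rewrite ler_pdivlMr ?subr_gt0 //.
  have [_ y1_eq _] := weierstrass_resolvent qwf (solve omega).
  have Sw_le : l1norm (usubmx (cmx S *m w omega)) <= W.
    apply: (@le_trans _ _ (l1norm (cmx S *m w omega))).
      by rewrite -[in leRHS](vsubmxK (cmx S *m _)) l1norm_col_mx lerDl l1norm_ge0.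
    rewrite (le_trans (HKS _)) // ler_wpM2l // (le_trans (l1normD _ _)) // lerD2l.
    rewrite (le_trans (l1norm_le_enorm _)) // ler_wpM2l ?ler0n //.
    exact: HM (lineO omega).
  have z_ge : `|omega| <= cmod (z omega) by exact: normr_Im_le (z omega).
  have zy1 : cmod (z omega) * l1norm (usubmx (y omega)) <=
      W + KJ * l1norm (usubmx (y omega)).
    rewrite -l1normZ -[_ *: _](subrK (cmx J *m usubmx (y omega))) y1_eq.
    by rewrite (le_trans (l1normD _ _)) // lerD.
  by have := l1norm_ge0 (usubmx (y omega)); nra.
have y2_le omega : l1norm (dsubmx (y omega)) <=
    \sum_(k < nu) (K k * nN%:R) * enorm (fimphat k (z omega)).
  rewrite y2E l1normN (le_trans (l1norm_sum _)) //; apply: ler_sum => k _.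
  have [K0 HKk] := HK k; rewrite (le_trans (HKk _)) // -mulrA ler_wpM2l //.
  exact: l1norm_le_enorm.
pose V (omega : R) := W / (`|omega| - KJ).
pose U omega := \sum_(k < nu) (K k * nN%:R) * enorm (fimphat k (z omega)).
have V0 : V @ at_infty (fun omega : R => `|omega|) setT --> (0 : R).
  apply/at_infty_cvg0P => e e0; exists (KJ + `|W| / e) => omega _ big.
  have We : 0 <= `|W| / e by rewrite divr_ge0 // ltW.
  have pos : 0 < `|omega| - KJ by lra.
  rewrite normrM normfV (gtr0_norm pos) ltr_pdivrMr // mulrC -ltr_pdivrMr //.
  by rewrite ltrBrDl.
have U0 : U @ at_infty (fun omega : R => `|omega|) setT --> (0 : R).
  rewrite (_ : 0 = \sum_(k < nu) (K k * nN%:R) * 0); last first.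
    by rewrite big1 // => k _; rewrite mulr0.
  apply: cvg_lincomb => k; apply/at_infty_cvg0P => e e0.
  have [M' HM'] := (at_infty_cvg0P _ _ _).1 (decay_imp k (ltn_ord k)) e e0.
  exists M' => omega _ big; apply: HM'; first exact: lineO.
  exact: lt_le_trans big (normr_Im_le (z omega)).
pose B := expR (gamma * t) * KT.
have B0 : 0 <= B by rewrite mulr_ge0 // expR_ge0.
have lim0 : B * (V omega + U omega) @[omega --> at_infty (fun omega : R => `|omega|) setT]
    --> (0 : R).
  rewrite -[X in _ --> X](mulr0 B) -[X in _ --> B * X](addr0 0).
  by apply: cvgM; [exact: cvg_cst|exact: cvgD].
apply: (@squeeze_cvgr _ _ _ _ (fun=> 0)) lim0; last exact: cvg_cst.
exists KJ => // omega [_ big] /=; rewrite sqrtr_ge0 /=.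
rewrite (le_trans (enorm_le_l1norm _)) // l1normZ.
rewrite cmod_cexp -[gamma +i* omega]/(z omega) Re_mulrC /= /B -mulrA.
rewrite ler_wpM2l ?expR_ge0 //.
have [xE _ _] := weierstrass_resolvent qwf (solve omega).
rewrite xE -/(y omega) (le_trans (HKT _)) // ler_wpM2l //.
by rewrite -[y omega]vsubmxK l1norm_col_mx lerD //; exact: y1_le.
Qed.
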